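(* Let $L$ and $L_0$ be Finsler metrics on an $n$-dimensional compact manifold $M$ and let $0\le k\le n$ be an integer. Then $$\tilde W_k(M;L,L_0)^n\le\frac{\mathrm{vol}(M,L)^{n-k}}{\mathrm{vol}(M,L_0)^{n-k}}.$$
   Context: A Finsler metric on a manifold $M$ is a function $L:TM\to[0,\infty)$ that is positive and smooth outside the zero section, positively homogeneous of degree one, and whose unit sphere in each $T_xM$ is quadratically convex (positive principal curvatures for any auxiliary Euclidean structure on $T_xM$); it need not satisfy $L(v)=L(-v)$. Its Hamiltonian $H:T^*M\to[0,\infty)$ is the fibrewise dual, $H(p)=\max\{p(v): L(v)\le 1\}$. $D^*(M,H)=\{p\in T^*M: H(p)\le 1\}$ and $S^*(M,H)=\{H=1\}$. $\alpha$ is the canonical 1-form on $T^*M$ ($\alpha=\sum p_i\,dq_i$), $\omega=d\alpha$, $V$ is the volume given by $\omega^n/n!$, and $\Omega=\alpha\wedge(d\alpha)^{n-1}/n!$. The (Holmes-Thompson) volume is $\mathrm{vol}(M,L)=V(D^*(M,H))/\varepsilon_n$, where $\varepsilon_n$ is the volume of the Euclidean unit ball of dimension $n$. For Finsler metrics $L,L_0$ with Hamiltonians $H,H_0$, $$\tilde W_k(M;L,L_0)=\frac{1}{V(D^*(M,H_0))}\int_{S^*(M,H_0)}\rho^{\,n-k}\,\Omega,$$ where $\rho$ denotes the restriction of $1/H$ to $S^*(M,H_0)$ and $S^*(M,H_0)$ is oriented as the boundary of $D^*(M,H_0)$. (The paper also abbreviates this as $\tilde W_k(M,L)$ when $L_0$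 is the fixed model metric.) *)

(* Defs.v *)
From HB Require Import structures.
From mathcomp Require Import all_boot all_order all_fingroup all_algebra.
From mathcomp Require Import all_classical all_reals all_analysis.
Set Implicit Arguments.
Unset Strict Implicit.
Unset Printing Implicit Defensive.
Import Order.TTheory GRing.Theory Num.Theory.
Import numFieldNormedType.Exports.
Local Open Scope classical_set_scope.
Local Open Scope ring_scope.

(* [A] is meant to be open and [V] finite-dimensional. *)
Fixpoint Ck_on (R : realType) (V W : normedModType R) (k : nat)
    (A : set V) (f : V -> W) : Prop :=
  match k with
  | 0%N => forall x, A x -> {for x, continuous f}
  | k'.+1 => (forall x, A x -> differentiable f x) /\
             (forall v, Ck_on k' A (fun x => 'D_v f x))
  end.

Definition smooth_on (R : realType) (V W : normedModType R)
    (A : set V) (f : V -> W) : Prop := forall k, Ck_on k A f.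

(* [phi i] is meaningful on [dom i] only, and [psi i], its inverse, on
   [phi i @` dom i] only.  [chart_at x] is a preferred chart around [x]; it
   is used below solely to name the vectors of the tangent space at [x]. *)
Record smoothManifold (R : realType) (d : nat) := SmoothManifold {
  carrier :> topologicalType ;
  mfd_hausdorff : hausdorff_space carrier ;
  mfd_countable : @second_countable carrier ;
  chart : Type ;
  dom : chart -> set carrier ;
  phi : chart -> carrier -> 'rV[R]_d ;
  psi : chart -> 'rV[R]_d -> carrier ;
  chart_at : carrier -> chart ;
  dom_open : forall i, open (dom i) ;
  img_open : forall i, open (phi i @` dom i) ;
  phiK : forall i x, dom i x -> psi i (phi i x) = x ;
  phi_continuous : forall i x, dom i x -> {for x, continuous (phi i)} ;
  psi_continuous : forall i u, (phi i @` dom i) u ->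
    {for u, continuous (psi i)} ;
  transition_smooth : forall i j,
    smooth_on (phi i @` (dom i `&` dom j)) (phi j \o psi i) ;
  chart_atP : forall x, dom (chart_at x) x
}.

Definition img (R : realType) (d : nat) (M : smoothManifold R d)
  (i : chart M) : set 'rV[R]_d := phi i @` dom i.

Record partition_of_unity (R : realType) (d : nat) (M : smoothManifold R d) :=
  PartitionOfUnity {
  pou_size : nat ;
  pou_chart : 'I_pou_size -> chart M ;
  pou_fun : 'I_pou_size -> M -> R^o ;
  pou_ge0 : forall a x, 0 <= pou_fun a x ;
  pou_sum1 : forall x, \sum_(a < pou_size) pou_fun a x = 1 ;
  pou_supp : forall a,
    closure [set x | pou_fun a x != 0] `<=` dom (pou_chart a) ;
  pou_smooth : forall a i, smooth_on (img i) (pou_fun a \o psi i)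
}.

(* The tangent space at [x] is [R^d], a vector being named by its components
   in the preferred chart at [x]; the cotangent space is its dual, a covector
   being named by its components in the dual basis. *)

Definition pairing (R : realType) (d : nat) (p v : 'rV[R]_d) : R :=
  \sum_(k < d) p ord0 k * v ord0 k.

(* The tangent vector at [x] with components [w] in the chart [i]. *)
Definition tan_of_chart (R : realType) (d : nat) (M : smoothManifold R d)
    (i : chart M) (x : M) (w : 'rV[R]_d) : 'rV[R]_d :=
  w *m jacobian (phi (chart_at x) \o psi i) (phi i x).

(* The covector at [x] with components [xi] in the chart [i], that is
   [v |-> pairing xi (v *m J)] where [J] is the Jacobian matrix below. *)
Definition cot_of_chart (R : realType) (d : nat) (M : smoothManifold R d)
    (i : chart M) (x : M) (xi : 'rV[R]_d) : 'rV[R]_d :=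
  xi *m (jacobian (phi i \o psi (chart_at x)) (phi (chart_at x) x))^T.

Section QuadraticConvexity.
Variables (R : realType) (d : nat).

Definition euclidean_structure (G : 'M[R]_d) : Prop :=
  G^T = G /\ forall v : 'rV[R]_d, v != 0 -> 0 < (v *m G *m v^T) ord0 ord0.

Definition gradient (G : 'M[R]_d) (N : 'rV[R]_d -> R^o) (v : 'rV[R]_d) :
    'rV[R]_d :=
  (\row_k 'D_(delta_mx ord0 k) N v) *m invmx G.

Definition unit_normal (G : 'M[R]_d) (N : 'rV[R]_d -> R^o) (v : 'rV[R]_d) :
    'rV[R]_d :=
  let g := gradient G N v in
  (Num.sqrt ((g *m G *m g^T) ord0 ord0))^-1 *: g.

(* Eigenvalues of the shape operator [w |-> D_w nu] of the level hypersurface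
   of [N] through [v], [nu] being the outward unit normal; the sign is such
   that round spheres have positive curvatures. *)
Definition principal_curvature (G : 'M[R]_d) (N : 'rV[R]_d -> R^o)
    (v : 'rV[R]_d) (kappa : R) : Prop :=
  exists w : 'rV[R]_d, [/\ w != 0, 'D_w N v = 0 &
    'D_w (unit_normal G N) v = kappa *: w].

Definition quadratically_convex (N : 'rV[R]_d -> R^o) : Prop :=
  forall G, euclidean_structure G ->
  forall v, N v = 1 -> forall kappa, principal_curvature G N v kappa ->
  0 < kappa.

End QuadraticConvexity.

Record finsler (R : realType) (d : nat) (M : smoothManifold R d) := Finsler {
  finsler_fun :> M -> 'rV[R]_d -> R^o ;
  finsler_ge0 : forall x v, 0 <= finsler_fun x v ;
  finsler_gt0 : forall x v, v != 0 -> 0 < finsler_fun x v ;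
  finsler_homog : forall x (t : R) v, 0 < t ->
    finsler_fun x (t *: v) = t * finsler_fun x v ;
  finsler_smooth : forall i : chart M,
    smooth_on [set z : 'rV[R]_(d + d) | img i (lsubmx z) /\ rsubmx z != 0]
      (fun z => finsler_fun (psi i (lsubmx z))
                  (tan_of_chart i (psi i (lsubmx z)) (rsubmx z))) ;
  finsler_convex : forall x, quadratically_convex (finsler_fun x)
}.

Definition hamiltonian (R : realType) (d : nat) (M : smoothManifold R d)
    (L : finsler M) (x : M) (p : 'rV[R]_d) : R :=
  sup [set pairing p v | v in [set v | L x v <= 1]].

Definition Dstar (R : realType) (d : nat) (M : smoothManifold R d)
    (L : finsler M) : set (M * 'rV[R]_d) :=
  [set c | hamiltonian L c.1 c.2 <= 1].

Definition form (R : realType) (N k : nat) : Type :=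
  'rV[R]_N -> ('I_k -> 'rV[R]_N) -> R^o.

(* Normalised so that [(dx /\ dy) (e_x, e_y) = 1]. *)
Definition wedge (R : realType) (N k l : nat)
    (eta : form R N k) (xi : form R N l) : form R N (k + l) :=
  fun z v => ((k`! * l`!)%:R)^-1 *
    \sum_(s : 'S_(k + l)) (-1) ^+ s *
      (eta z (fun a => v (s (lshift l a))) *
       xi z (fun b => v (s (rshift k b)))).

Fixpoint wedge_pow (R : realType) (N k : nat) (eta : form R N k) (m : nat) :
    form R N (m * k) :=
  match m return form R N (m * k) with
  | 0%N => fun _ _ => 1
  | m'.+1 => wedge eta (@wedge_pow R N k eta m')
  end.
Arguments wedge_pow {R N k} eta m.

Definition extd (R : realType) (N k : nat) (eta : form R N k) :
    form R N k.+1 :=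
  fun z v => \sum_(a < k.+1) (-1) ^+ a *
    'D_(v a) (fun y => eta y (fun b => v (lift a b)) : R^o) z.

(* A chart [i] of [M] gives canonical coordinates [z = row_mx q p] on the part
   of the cotangent bundle lying over [dom i]; [alpha], [omega], [vol_form] and
   [Omega] have the same expression in all of them. *)

Section Canonical.
Variables (R : realType) (d : nat).

Definition alpha : form R (d + d) 1 :=
  fun z v => pairing (rsubmx z) (lsubmx (v ord0)).

Definition omega : form R (d + d) 2 := extd alpha.

Definition vol_form : form R (d + d) (d * 2) :=
  fun z v => (d`!%:R)^-1 * wedge_pow omega d z v.

Variable M : smoothManifold R d.

Definition cot_point (i : chart M) (z : 'rV[R]_(d + d)) : M * 'rV[R]_d :=
  let x := psi i (lsubmx z) in (x, cot_of_chart i x (rsubmx z)).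

Definition hamiltonian_coord (L : finsler M) (i : chart M)
    (z : 'rV[R]_(d + d)) : R :=
  let c := cot_point i z in hamiltonian L c.1 c.2.

End Canonical.

Definition Omega (R : realType) (n : nat) :
    form R (n.+1 + n.+1) (1 + n * 2) :=
  fun z v => ((n.+1)`!%:R)^-1 *
    wedge (@alpha R n.+1) (wedge_pow (@omega R n.+1) n) z v.

(* Lebesgue integral over R^N, as an iterated integral: all the integrands
   below are nonnegative Borel functions, so Tonelli's theorem applies. *)
Fixpoint integral_rV (R : realType) (N : nat) :
    ('rV[R]_N -> \bar R) -> \bar R :=
  match N return ('rV[R]_N -> \bar R) -> \bar R with
  | 0%N => fun f => f 0
  | N'.+1 => fun f =>
      (\int[@lebesgue_measure R]_(t in [set: R])
        integral_rV (fun y : 'rV[R]_N' => f (row_mx (t%:M : 'rV[R]_1) y)))%E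
  end.

Lemma basis_card (d : nat) : (d * 2 = d + d)%N.
Proof. by rewrite muln2 addnn. Qed.

Lemma frame_card (n : nat) : (1 + n * 2 = n.+1 + n)%N.
Proof. by rewrite muln2 -addnn. Qed.

(* The volume of a subset of the cotangent bundle for omega^d / d!, computed
   with a partition of unity pulled back from [M]; as usual the value does not
   depend on the partition of unity. *)
Definition cot_volume (R : realType) (d : nat) (M : smoothManifold R d)
    (P : partition_of_unity M) (A : set (M * 'rV[R]_d)) : R :=
  fine (\sum_(a < pou_size P)
    integral_rV (fun z : 'rV[R]_(d + d) =>
      ((\1_[set z | img (pou_chart a) (lsubmx z) /\
                    A (cot_point (pou_chart a) z)] z) *
       (pou_fun a (psi (pou_chart a) (lsubmx z)) *
        `|vol_form z (fun k => delta_mx ord0 (cast_ord (basis_card d) k))|))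
      %:E))%E.

Definition ball_volume (R : realType) (d : nat) : R :=
  fine (integral_rV (fun x : 'rV[R]_d =>
    (\1_[set x : 'rV[R]_d | \sum_(k < d) x ord0 k ^+ 2 <= 1] x)%:E)).

Section CosphereBundle.
Variables (R : realType) (n : nat) (M : smoothManifold R n.+1).

(* Over [dom i], the cosphere bundle [{H = 1}] of [L] is the union of the graphs
   [cosphere_param L i j b], [j < n.+1], [b : bool]: the point with parameter
   [row_mx q y] lies over [q], on the ray through the covector whose [j]-th
   component is [(-1) ^+ b] and whose other components are those of [y].
   Restricted to [|y_k| <= 1], i.e. to the rays whose largest component in
   absolute value is the [j]-th, with sign [(-1) ^+ b], these graphs only
   overlap along sets of measure zero. *)
Definition cosphere_param (L : finsler M) (i : chart M) (j : 'I_n.+1)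
    (b : bool) (u : 'rV[R]_(n.+1 + n)) : 'rV[R]_(n.+1 + n.+1) :=
  let q := lsubmx u in
  let xi : 'rV[R]_n.+1 :=
    \row_k (if unlift j k is Some k' then rsubmx u ord0 k' else (-1) ^+ b) in
  row_mx q ((hamiltonian_coord L i (row_mx q xi))^-1 *: xi).

Definition cosphere_frame (L : finsler M) (i : chart M) (j : 'I_n.+1)
    (b : bool) (u : 'rV[R]_(n.+1 + n)) (k : 'I_(1 + n * 2)) :
    'rV[R]_(n.+1 + n.+1) :=
  'D_(delta_mx ord0 (cast_ord (frame_card n) k)) (cosphere_param L i j b) u.

(* The cotangent bundle is oriented by [omega^(n+1)] and the cosphere bundle
   as the boundary of the codisc bundle (outward normal first); the radial
   vector [(0, p)] points outward because hamiltonians are homogeneous. *)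
Definition orientation (L : finsler M) (i : chart M) (j : 'I_n.+1)
    (b : bool) (u : 'rV[R]_(n.+1 + n)) : R :=
  let z := cosphere_param L i j b u in
  Num.sg (vol_form z (fun k : 'I_(1 + n * 2).+1 =>
    if unlift ord0 k is Some k' then cosphere_frame L i j b u k'
    else row_mx 0 (rsubmx z))).

(* The integral of [f * eta] over the oriented cosphere bundle of [L]; [eta]
   is the expression of a form in canonical coordinates (the same for all
   charts, as is the case for [Omega]). *)
Definition cosphere_integral (P : partition_of_unity M) (L : finsler M)
    (f : M * 'rV[R]_n.+1 -> R) (eta : form R (n.+1 + n.+1) (1 + n * 2)) : R :=
  fine (\sum_(a < pou_size P) \sum_(j < n.+1) \sum_(b : bool)
    integral_rV (fun u : 'rV[R]_(n.+1 + n) =>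
      let i := pou_chart a in
      let z := cosphere_param L i j b u in
      ((\1_[set u : 'rV[R]_(n.+1 + n) | img i (lsubmx u) /\
              forall k, `|rsubmx u ord0 k| <= 1] u) *
       (pou_fun a (psi i (lsubmx u)) * f (cot_point i z) *
        (orientation L i j b u * eta z (cosphere_frame L i j b u))))%:E))%E.

Definition holmes_thompson (P : partition_of_unity M) (L : finsler M) : R :=
  cot_volume P (Dstar L) / ball_volume R n.+1.

Definition Wtilde (P : partition_of_unity M) (k : nat) (L L0 : finsler M) :
    R :=
  (cot_volume P (Dstar L0))^-1 *
  cosphere_integral P L0
    (fun c => (1 / hamiltonian L c.1 c.2) ^+ (n.+1 - k)) (@Omega R n).

End CosphereBundle.

(* Main.v *)
Require Import Defs.
From mathcomp Require Import all_boot all_order all_fingroup all_algebra.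
From mathcomp Require Import all_classical all_reals all_analysis.
From mathcomp Require Import measurable_realfun ring lra zify.
Import Order.TTheory GRing.Theory Num.Theory.
Import numFieldNormedType.Exports.
Local Open Scope classical_set_scope.
Local Open Scope ring_scope.

(* In the canonical coordinates of a chart, [Omega] on the cosphere bundle of
   [H0], parametrised by the ray through [xi], has density [H0 (xi) ^- (n+1)]
   up to a constant factor, because the contraction of [omega^(n+1)] with the
   radial field is a multiple of [Omega]; integrating in polar coordinates, the
   volume of [{H <= 1}] is the integral of [H (xi) ^- (n+1)] with the same
   constant.  Hence [Wtilde P k L L0] is the integral of
   [H0 (xi) ^- k * H (xi) ^- (n+1-k)] divided by [V (D^* (M, H0))], and the
   theorem is Hoelder's inequality, obtained by optimising the weights of an
   integrated AM-GM inequality.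

   Upper bounds suffice for the numerator of [Wtilde] and lower bounds for the
   volumes.  In particular the differentiability of the Hamiltonian is never
   needed: where it fails, the frame of the cosphere bundle contains a zero
   vector (the junk value of ['D_v]), so the density vanishes. *)

(** * Alternating sums and the powers of omega *)

(** [Omega] and [orientation] come from the same contraction, so their product is an absolute value:
    the cosphere integrand is nonnegative and no sign has to be computed. That integrand is built
    from derivatives of the parametrisation; it is compared pointwise with a measurable majorant,
    because the integral of a nonnegative function is a supremum over simple functions and hence
    monotone. The majorant is Borel because a Hamiltonian is a supremum of functions continuous in
    [(q, p)], hence lower semicontinuous. The constant [c] relating [vol_form] to the determinant is
    left unknown: [|c|] multiplies the volumes and the bound on the cosphere integral alike. The
    iterated integral [integral_rV] is handled by induction on the dimension, with Tonelli's theorem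
    applied to one real coordinate at a time. Compactness of [M] gives finiteness: [fine] sends
    infinity to zero, so a volume can serve as an upper bound only once it is known to be finite.
    Conversely a zero volume for [L0] is harmless, its inverse being zero. *)

Lemma split_lshift {k l : nat} (a : 'I_k) : fintype.split (lshift l a) = inl a.
Proof. exact: (unsplitK (inl a)). Qed.

Lemma split_rshift {k l : nat} (b : 'I_l) : fintype.split (rshift k b) = inr b.
Proof. exact: (unsplitK (inr b)). Qed.

Definition sum_perm_fun {k l : nat} (s : 'S_k) (t : 'S_l) (i : 'I_(k + l)) : 'I_(k + l) :=
  match fintype.split i with inl a => lshift l (s a) | inr b => rshift k (t b) end.

Lemma sum_perm_inj {k l : nat} (s : 'S_k) (t : 'S_l) : injective (sum_perm_fun s t).
Proof.
apply: (can_inj (g := sum_perm_fun s^-1 t^-1)) => i; rewrite /sum_perm_fun.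
by case: (split_ordP i) => a ->;
  rewrite ?split_lshift ?split_rshift permK.
Qed.

Definition sum_perm {k l : nat} (s : 'S_k) (t : 'S_l) : 'S_(k + l) :=
  perm (sum_perm_inj s t).

Lemma sum_perm_lshift {k l : nat} (s : 'S_k) (t : 'S_l) i :
  sum_perm s t (lshift l i) = lshift l (s i).
Proof. by rewrite permE /sum_perm_fun split_lshift. Qed.

Lemma sum_perm_rshift {k l : nat} (s : 'S_k) (t : 'S_l) i :
  sum_perm s t (rshift k i) = rshift k (t i).
Proof. by rewrite permE /sum_perm_fun split_rshift. Qed.

(** The matrix of [sum_perm s t] is block diagonal with the matrices of [s] and [t] as blocks, and a
    sign is the determinant of a permutation matrix. *)
Lemma sign_sum_perm {R : comNzRingType} {k l : nat} (s : 'S_k) (t : 'S_l) :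
  (-1) ^+ sum_perm s t = (-1) ^+ s * (-1) ^+ t :> R.
Proof.
rewrite -!det_perm -(det_ublock _ 0); congr (\det _).
apply/matrixP => i j; rewrite mxE.
case: (split_ordP i) => a ->; rewrite ?sum_perm_lshift ?sum_perm_rshift;
  case: (split_ordP j) => b ->;
  by rewrite ?block_mxEul ?block_mxEur ?block_mxEdl ?block_mxEdr !mxE
    ?eq_shift.
Qed.

(** Not divided by a factorial: the factor in [wedge] is then exactly what turns the alternations of
    [F] and [G] into the alternation of their tensor product. *)
Definition alt {R : comNzRingType} {V : Type} {N : nat} (F : ('I_N -> V) -> R)
  (v : 'I_N -> V) : R := \sum_(s : 'S_N) (-1) ^+ s * F (fun i => v (s i)).

Definition tensor {R : comNzRingType} {V : Type} {k l : nat}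
    (F : ('I_k -> V) -> R) (G : ('I_l -> V) -> R) (v : 'I_(k + l) -> V) : R :=
  F (fun a => v (lshift l a)) * G (fun b => v (rshift k b)).

(** Expanding both inner alternations gives a sum over pairs [(a, b)]; translating the outer sum by
    [sum_perm a b] makes every pair contribute the same value. *)
Lemma alt_tensor_alt {R : comNzRingType} {V : Type} {k l : nat}
    (F : ('I_k -> V) -> R) (G : ('I_l -> V) -> R) v :
  alt (tensor (alt F) (alt G)) v = (k`! * l`!)%:R * alt (tensor F G) v.
Proof.
rewrite {1}/alt /tensor.
have AC (x y z f g : R) : x * ((y * f) * (z * g)) = y * z * x * (f * g) by ring.
have E (s : 'S_(k + l)) : (-1) ^+ s * (alt F (fun a => v (s (lshift l a))) *
    alt G (fun b => v (s (rshift k b)))) =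
  \sum_(a : 'S_k) \sum_(b : 'S_l) (-1) ^+ (sum_perm a b * s)%g *
   tensor F G (fun i => v ((sum_perm a b * s)%g i)).
  rewrite /alt big_distrlr /= big_distrr /=; apply: eq_bigr => a _.
  rewrite big_distrr /=; apply: eq_bigr => b _.
  rewrite odd_permM signr_addb sign_sum_perm /tensor.
  rewrite (_ : (fun i => v ((sum_perm a b * s)%g (lshift l i))) =
    fun i => v (s (lshift l (a i)))); last first.
    by apply/funext => i; rewrite permM sum_perm_lshift.
  rewrite (_ : (fun i => v ((sum_perm a b * s)%g (rshift k i))) =
    fun i => v (s (rshift k (b i)))); last first.
    by apply/funext => i; rewrite permM sum_perm_rshift.
  exact: AC.
under eq_bigr do rewrite E.
rewrite exchange_big /=; under eq_bigr do rewrite exchange_big /=.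
rewrite (_ : \sum_(i : 'S_k) _ =
  \sum_(a : 'S_k) \sum_(b : 'S_l) alt (tensor F G) v); last first.
  apply: eq_bigr => a _; apply: eq_bigr => b _.
  by rewrite /alt [RHS](reindex_inj (mulgI (sum_perm a b))).
by rewrite !sumr_const !card_Sn -mulrnA mulr_natl mulnC.
Qed.

Lemma wedge_alt {R : realType} {N k l : nat}
    (F : ('I_k -> 'rV[R]_N) -> R) (G : ('I_l -> 'rV[R]_N) -> R) z v :
  wedge (fun _ => alt F) (fun _ => alt G) z v = alt (tensor F G) v.
Proof.
rewrite /wedge -/(alt (tensor (alt F) (alt G)) v) alt_tensor_alt mulKf.
  by [].
by rewrite pnatr_eq0 -lt0n muln_gt0 !fact_gt0.
Qed.

Definition ord21 : 'I_2 := lift ord0 ord0.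

(** The sum over [k] of the tensors of [dp_k] with [dq_k]; its alternation is [omega]. *)
Definition pair2 {R : realType} {d : nat} (v : 'I_2 -> 'rV[R]_(d + d)) : R :=
  pairing (rsubmx (v ord0)) (lsubmx (v ord21)).

Fixpoint pair_pow (R : realType) (d m : nat) : ('I_(m * 2) -> 'rV[R]_(d + d)) -> R :=
  match m return ('I_(m * 2) -> 'rV[R]_(d + d)) -> R with
  | 0%N => fun _ => 1
  | m'.+1 => tensor pair2 (@pair_pow R d m')
  end.
Arguments pair_pow {R d} m.

Lemma derive_alpha {R : realType} {d : nat} (z w u : 'rV[R]_(d + d)) :
  'D_w (fun y : 'rV[R]_(d + d) => pairing (rsubmx y) (lsubmx u) : R^o) z =
  pairing (rsubmx w) (lsubmx u).
Proof.
rewrite /derive; apply: cvg_lim => //.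
apply: cvg_near_cst; exists 1 => //= t _ t0.
rewrite /pairing -sumrB /= /GRing.scale /= big_distrr /=; apply: eq_bigr => i _.
by rewrite !mxE; field.
Qed.

Lemma omegaE {R : realType} {d : nat} (z : 'rV[R]_(d + d)) v : omega z v = alt pair2 v.
Proof.
rewrite /omega /extd /alt /alpha big_ord_recl big_ord1 !derive_alpha.
rewrite (bigD1 1%g) //= (bigD1 (tperm ord0 ord21)) //=; last first.
  by apply/eqP => /permP /(_ ord0); rewrite tpermL perm1.
(* Two slots admit no permutation besides the identity and the transposition. *)
rewrite big1; last first.
  move=> s /andP[s1 s2]; case/eqP: s2.
  have S01 (i : 'I_2) : i = ord0 \/ i = ord21.
    by case: i => [[|[]]]//= H; [left|right]; apply/val_inj.
  have N01 : ord0 <> ord21 by [].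
  have s01 : s ord0 <> s ord21 by move/perm_inj.
  apply/permP => i; case: (S01 i) => ->; rewrite ?tpermL ?tpermR.
    case: (S01 (s ord0)) => // s00; case/eqP: s1; apply/permP => j; rewrite perm1.
    case: (S01 j) => ->//; case: (S01 (s ord21)) => //; by rewrite -s00 => /esym.
  case: (S01 (s ord21)) => // s11; case/eqP: s1; apply/permP => j; rewrite perm1.
  case: (S01 j) => ->//; case: (S01 (s ord0)) => //; by rewrite -s11.
rewrite /pair2 odd_perm1 odd_tperm /= !expr0 !expr1 addr0 !perm1 tpermL tpermR.
have -> : lift ord0 (ord0 : 'I_1) = ord21 by [].
by rewrite (_ : lift ord21 ord0 = ord0)//; apply/val_inj.
Qed.

Lemma alt0 {R : comNzRingType} {V : Type} (F : ('I_0 -> V) -> R) (v : 'I_0 -> V) : alt F v = F v.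
Proof.
rewrite /alt (bigD1 1%g) //= big1 ?odd_perm1 ?expr0 ?mul1r ?addr0.
  by congr F; apply/funext => -[].
by move=> s /eqP[]; apply/permP => -[].
Qed.

Lemma alt1 {R : comNzRingType} {V : Type} (F : ('I_1 -> V) -> R) (v : 'I_1 -> V) : alt F v = F v.
Proof.
rewrite /alt (bigD1 1%g) //= big1 ?odd_perm1 ?expr0 ?mul1r ?addr0.
  by congr F; apply/funext => i; rewrite perm1.
by move=> s /eqP[]; apply/permP => i; rewrite !ord1.
Qed.

Lemma wedge_pow_omegaE {R : realType} {d : nat} (m : nat) :
  wedge_pow (@omega R d) m = fun _ => alt (pair_pow m).
Proof.
have oE : @omega R d = fun _ => alt pair2.
  by apply/funext => z; apply/funext => v; exact: omegaE.
elim: m => [|m IH]; apply/funext => z; apply/funext => v; first by rewrite alt0.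
rewrite -[RHS](wedge_alt pair2 (pair_pow m) z).
by rewrite -IH -oE.
Qed.

(** * Slots of the powers of omega, and the volume form as a determinant *)

Lemma pair_idx_subproof {m : nat} (i : 'I_m) (b : bool) : (i * 2 + b < m * 2)%N.
Proof. by have := ltn_ord i; case: b => /=; lia. Qed.

Definition pair_idx {m : nat} (i : 'I_m) (b : bool) : 'I_(m * 2) :=
  Ordinal (pair_idx_subproof i b).

Lemma pair_powE {R : realType} {d m : nat} (v : 'I_(m * 2) -> 'rV[R]_(d + d)) :
  pair_pow m v =
  \prod_(i < m) pairing (rsubmx (v (pair_idx i false))) (lsubmx (v (pair_idx i true))).
Proof.
elim: m v => [|m IH] v /=; first by rewrite big_ord0.
rewrite big_ord_recl /tensor IH; congr (_ * _).
  by rewrite /pair2; congr (pairing (rsubmx (v _)) (lsubmx (v _))); apply/val_inj.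
apply: eq_bigr => i _.
by congr (pairing (rsubmx (v _)) (lsubmx (v _))); apply/val_inj => /=;
  rewrite /bump /=; lia.
Qed.

Definition pair_unidx {m : nat} (a : 'I_(m * 2)) : 'I_m * bool :=
  (Ordinal (etrans (ltn_divLR _ _ (isT : (0 < 2)%N)) (ltn_ord a)), odd a).

Lemma pair_idxK {m : nat} (i : 'I_m) (b : bool) : pair_unidx (pair_idx i b) = (i, b).
Proof.
congr pair; last by rewrite /= oddD oddM andbF; case: b.
by apply/val_inj => /=; case: b; lia.
Qed.

Lemma pair_unidxK {m : nat} (a : 'I_(m * 2)) : pair_idx (pair_unidx a).1 (pair_unidx a).2 = a.
Proof. by apply/val_inj => /=; lia. Qed.

Lemma big_pair_idx {R : comNzRingType} {m : nat} (F : 'I_(m * 2) -> R) :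
  \prod_a F a = \prod_(i < m) (F (pair_idx i false) * F (pair_idx i true)).
Proof.
rewrite (reindex (fun ib : 'I_m * bool => pair_idx ib.1 ib.2)); last first.
  exists pair_unidx => [[i b]|a] _; [exact: pair_idxK|exact: pair_unidxK].
rewrite -(pair_bigA _ (fun i b => F (pair_idx i b))) /=.
by apply: eq_bigr => i _; rewrite big_bool /= mulrC.
Qed.

(** The left side is the Leibniz expansion of the determinant with entries [v a ord0 (f b)], and
    this matrix is a product. The factor free of [v] is a sign if [f] is a permutation and zero
    otherwise. *)
Lemma alt_prod_det {R : realType} {N : nat} (v : 'I_N -> 'rV[R]_N) (f : 'I_N -> 'I_N) :
  alt (fun w => \prod_a w a ord0 (f a)) v =
  \det (\matrix_(a, b) (a == f b)%:R) * \det (\matrix_a v a).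
Proof.
rewrite mulrC -det_mulmx -det_tr /alt /determinant; apply: eq_bigr => s _; congr (_ * _).
apply: eq_bigr => a _; rewrite !mxE (bigD1 (f a)) //= !mxE eqxx mulr1 big1 ?addr0 //.
by move=> j jf; rewrite !mxE (negPf jf) mulr0.
Qed.

(** Distributing the product of pairings over their sums leaves products of single coordinates, each
    of which alternates to a multiple of the determinant. *)
Lemma vol_form_det {R : realType} (d : nat) : exists c : R, forall (z : 'rV[R]_(d + d)) v,
  vol_form z v = c * \det (\matrix_a v (cast_ord (esym (basis_card d)) a)).
Proof.
(* If the [i]-th pairing contributes its term of index [k i], then slot [2i] is read in the momentum
   coordinate and slot [2i+1] in the position coordinate of that index. *)
pose g (k : {ffun 'I_d -> 'I_d}) (a : 'I_(d * 2)) : 'I_(d + d) :=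
  let: (i, b) := pair_unidx a in if b then lshift d (k i) else rshift d (k i).
have cK := cast_ordK (basis_card d); have cK' := cast_ordKV (basis_card d).
exists ((d`!%:R)^-1 * \sum_k \det (\matrix_(a, b) (a == g k (cast_ord (esym (basis_card d)) b))%:R)).
move=> z v; rewrite /vol_form -mulrA (wedge_pow_omegaE d) mulr_suml; congr (_ * _).
rewrite (_ : pair_pow d = fun v => \sum_k \prod_a v a ord0 (g k a)); last first.
  apply/funext => w; rewrite pair_powE /pairing bigA_distr_bigA /=.
  apply: eq_bigr => k _; rewrite big_pair_idx; apply: eq_bigr => i _.
  by rewrite /g !pair_idxK !mxE.
rewrite {1}/alt; under eq_bigr do rewrite mulr_sumr.
rewrite exchange_big /=; apply: eq_bigr => k _; rewrite -alt_prod_det.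
(* Once the equality of dimensions is generalised, destructing it turns the casts into
   identities. *)
move: (basis_card d) (esym _) cK cK' => e; case: _ / e v (g k) => v gk e' cK cK'.
rewrite /alt; apply: eq_bigr => s _; congr (_ * _); apply: eq_bigr => a _.
by rewrite !cast_ord_id.
Qed.

(* Contraction of [omega^(n+1)] with a radial vector: the terms in which [E]
   occupies the first slot of the i-th pair contribute equally for all i. *)
Lemma alt_pair_pow_radial {R : realType} {n : nat} (E : 'rV[R]_(n.+1 + n.+1))
    (v : 'I_(1 + n * 2) -> 'rV[R]_(n.+1 + n.+1)) : lsubmx E = 0 ->
  alt (pair_pow n.+1) (fun k : 'I_(1 + n * 2).+1 =>
    if unlift ord0 k is Some k' then v k' else E) =
  n.+1%:R * alt (tensor (fun u : 'I_1 -> 'rV[R]_(n.+1 + n.+1) =>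
    pairing (rsubmx E) (lsubmx (u ord0))) (pair_pow n)) v.
Proof.
move=> lE; set w := fun k : 'I_(1 + n * 2).+1 => _.
have w0 : w ord0 = E by rewrite /w unlift_none.
have wl k : w (lift ord0 k) = v k by rewrite /w liftK.
pose tm (s : 'S_(n.+1 * 2)) := (-1) ^+ s * pair_pow n.+1 (fun i => w (s i)).
have -> : alt (pair_pow n.+1) w = \sum_s tm s by [].
have pt0 (x : 'rV[R]_n.+1) : pairing x 0 = 0.
  by rewrite /pairing big1 // => k _; rewrite mxE mulr0.
(* [E] has no base component, so a term with [E] in the second slot of a pair vanishes. *)
have tm_odd (s : 'S_(n.+1 * 2)) (i : 'I_n.+1) : s (pair_idx i true) = ord0 -> tm s = 0.
  move=> si; rewrite /tm pair_powE (bigD1 i) //= si w0 lE pt0 mul0r mulr0 //.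
have split_tm (s : 'S_(n.+1 * 2)) :
    tm s = \sum_(i < n.+1) (if s (pair_idx i false) == ord0 then tm s else 0).
  have [i [b sib]] : exists i b, s (pair_idx i b) = ord0.
    exists (pair_unidx (s^-1%g ord0)).1, (pair_unidx (s^-1%g ord0)).2.
    by rewrite pair_unidxK permKV.
  case: b sib => sib.
    rewrite (tm_odd _ _ sib) big1 // => j _; by case: ifP.
  rewrite (bigD1 i) //= sib eqxx big1 ?addr0 // => j ji.
  case: eqP => // sj; case/eqP: ji.
  have /perm_inj H : s (pair_idx j false) = s (pair_idx i false) by rewrite sj sib.
  by have := congr1 (fun a => (pair_unidx a).1) H; rewrite !pair_idxK.
under eq_bigr do rewrite split_tm.
rewrite exchange_big /=.
pose i0 : 'I_n.+1 := ord0.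
(* [sw i] exchanges the pairs [0] and [i] slot by slot. It is even, and [pair_pow] is symmetric in
   its pairs, so the terms with [E] in pair [i] match those with [E] in pair [0]. *)
pose sw (i : 'I_n.+1) : 'S_(n.+1 * 2) :=
  (tperm (pair_idx i0 false) (pair_idx i false) * tperm (pair_idx i0 true) (pair_idx i true))%g.
have pinj (i j : 'I_n.+1) b b' : pair_idx i b = pair_idx j b' -> i = j /\ b = b'.
  by move=> /(congr1 pair_unidx); rewrite !pair_idxK => -[].
have swE i j b : sw i (pair_idx j b) = pair_idx (tperm i0 i j) b.
  rewrite permM.
  have tE (k : 'I_n.+1) (b1 b2 : bool) : tperm (pair_idx i0 b1) (pair_idx i b1) (pair_idx k b2) =
    pair_idx (if b1 == b2 then tperm i0 i k else k) b2.
    case: (tpermP (pair_idx i0 b1)) => [/pinj[-> ->]|/pinj[-> ->]|k0 k1].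
    - by rewrite eqxx tpermL.
    - by rewrite eqxx tpermR.
    - case: eqP => // bb; rewrite bb in k0 k1; rewrite tpermD //.
        by apply/eqP => ik; apply: k0; rewrite ik.
      by apply/eqP => ik; apply: k1; rewrite ik.
  by rewrite tE; case: b; rewrite /= tE.
have sw_sgn i : odd_perm (sw i) = false.
  rewrite odd_permM !odd_tperm.
  have [<-|i0i] := eqVneq i0 i; first by rewrite !eqxx.
  have H b : pair_idx i0 b != pair_idx i b by apply/eqP => /pinj[/eqP]; rewrite (negPf i0i).
  by rewrite !H.
clearbody sw.
have tm_sw i s : tm (sw i * s)%g = tm s.
  rewrite /tm odd_permM sw_sgn addFb; congr (_ * _).
  rewrite !pair_powE [RHS](reindex_inj (@perm_inj _ (tperm i0 i))) /=.
  by apply: eq_bigr => j _; rewrite !permM !swE.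
rewrite (eq_bigr (fun=> \sum_(s : 'S_(n.+1 * 2)) if s ord0 == ord0 then tm s else 0)); last first.
  move=> i _; rewrite (reindex_inj (mulgI (sw i))) /=; apply: eq_bigr => s _.
  rewrite tm_sw permM swE tpermR; congr (if s _ == _ then _ else _).
  exact/val_inj.
rewrite sumr_const card_ord -[LHS]mulr_natl; congr (_ * _).
rewrite -big_mkcond /= /alt.
(* The permutations fixing the slot of [E] are the lifts of those of the other slots; [ulsf]
   provides the restriction. *)
rewrite (reindex (lift_perm ord0 ord0)) /=; last first.
  pose ulsf (s : 'S_(1 + n * 2).+1) (k : 'I_(1 + n * 2)) := odflt k (unlift (s ord0) (s (lift ord0 k))).
  have ulsfK (s : 'S_(1 + n * 2).+1) k : lift (s ord0) (ulsf s k) = s (lift ord0 k).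
    rewrite /ulsf; have:= neq_lift ord0 k.
    by rewrite -(can_eq (permK s)) => /unlift_some[] ? ? ->.
  have inj_ulsf s : injective (ulsf s).
    move=> a b /(congr1 (lift (s ord0))); rewrite !ulsfK => /perm_inj; exact: lift_inj.
  exists (fun s => perm (inj_ulsf s)) => [s _ | s].
    apply/permP=> k'; rewrite permE /ulsf lift_perm_lift lift_perm_id liftK //.
  rewrite inE => /eqP si0; apply/permP=> k.
  case: (unliftP ord0 k) => [k'|] ->; rewrite ?lift_perm_id //.
  by rewrite lift_perm_lift -[in LHS]si0 permE ulsfK.
apply: eq_big => [s|s _]; first by rewrite lift_perm_id eqxx.
rewrite /tm odd_lift_perm addFb; congr (_ * _).
rewrite /pair_pow -/(@pair_pow R n.+1 n) /tensor /pair2; congr (_ * _).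
  have -> : lshift (n * 2) (ord0 : 'I_2) = ord0 :> 'I_(1 + n * 2).+1 by apply/val_inj.
  have -> : lshift (n * 2) ord21 = lift ord0 (lshift (n * 2) (ord0 : 'I_1)) :> 'I_(1 + n * 2).+1.
    exact/val_inj.
  by rewrite lift_perm_id w0 lift_perm_lift wl.
congr (pair_pow n); apply/funext => b.
have -> : rshift 2 b = lift ord0 (rshift 1 b) :> 'I_(1 + n * 2).+1 by apply/val_inj.
by rewrite lift_perm_lift wl.
Qed.

(** [vol_form] and [Omega] carry the same factor [1/(n+1)!], so the contraction leaves exactly the
    number [n+1] of pairs. *)
Lemma vol_form_radial {R : realType} {n : nat} (z : 'rV[R]_(n.+1 + n.+1))
    (v : 'I_(1 + n * 2) -> 'rV[R]_(n.+1 + n.+1)) :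
  vol_form z (fun k : 'I_(1 + n * 2).+1 =>
    if unlift ord0 k is Some k' then v k' else row_mx 0 (rsubmx z)) =
  n.+1%:R * Omega z v.
Proof.
rewrite /vol_form wedge_pow_omegaE (alt_pair_pow_radial (row_mx 0 (rsubmx z))) ?row_mxKl //.
rewrite mulrCA /Omega; congr (_ * (_ * _)).
rewrite row_mxKr -(wedge_alt _ _ z) -wedge_pow_omegaE.
rewrite /wedge; congr (_ * _); apply: eq_bigr => s _.
by rewrite alt1.
Qed.

(* The cone frame at the ray through [xi], up to row operations and a
   permutation, is block triangular with diagonal blocks [1] and [r] times a
   matrix of determinant [+-xi_j]. *)
Lemma norm_det_cone_frame {R : realType} {n : nat} (j : 'I_n.+1) (r : R)
    (xi : 'rV[R]_n.+1) (t : 'I_n -> R)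
    (fr : 'I_(1 + n * 2) -> 'rV[R]_(n.+1 + n.+1)) :
  `|xi ord0 j| = 1 ->
  (forall k, lsubmx (fr (cast_ord (esym (frame_card n)) (lshift n k))) = delta_mx ord0 k) ->
  (forall k, fr (cast_ord (esym (frame_card n)) (rshift n.+1 k)) =
     row_mx 0 (r *: delta_mx ord0 (lift j k) + t k *: xi)) ->
  `|\det (\matrix_a (fun k : 'I_(1 + n * 2).+1 =>
      if unlift ord0 k is Some k' then fr k' else row_mx 0 (r *: xi))
    (cast_ord (esym (basis_card n.+1)) a))| = `|r| ^+ n.+1.
Proof.
move=> xij Hq Hy.
pose B : 'M[R]_n.+1 := \matrix_a (if unlift ord0 a is Some k
  then r *: delta_mx ord0 (lift j k) + t k *: xi else r *: xi).
pose C : 'M[R]_n.+1 := \matrix_k rsubmx (fr (cast_ord (esym (frame_card n)) (lshift n k))).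
(* The frame lists the radial vector before the base directions; [sg] moves its row to the top of
   the fibre block, at the price of a sign. *)
pose sg : 'S_(n.+1 + n.+1) := lift_perm ord0 (rshift n.+1 (ord0 : 'I_n.+1)) 1%g.
set W := (X in \det X).
have -> : W = row_perm sg (block_mx 1%:M C 0 B).
  apply/row_matrixP => a; rewrite rowK.
  case: (unliftP ord0 a) => [k|] ->.
    have e : (n.+1 + n = (n.+1 + n.+1).-1)%N by rewrite addnS.
    rewrite -(cast_ordKV e k); move: (cast_ord (esym e) k) => {}k.
    have -> : cast_ord (esym (basis_card n.+1)) (lift ord0 (cast_ord e k)) =
       lift ord0 (cast_ord (esym (frame_card n)) k) :> 'I_(1 + n * 2).+1 by exact/val_inj.
    rewrite liftK.
    apply/rowP => c; rewrite !mxE lift_perm_lift perm1.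
    case: (split_ordP k) => l ->.
      have -> : lift (rshift n.+1 (ord0 : 'I_n.+1)) (cast_ord e (lshift n l)) = lshift n.+1 l.
        by apply/val_inj; rewrite /= /bump addn0 leqNgt ltn_ord.
      rewrite split_lshift.
      case: (split_ordP c) => c' ->.
        have := congr1 (fun M : 'rV[R]_n.+1 => M ord0 c') (Hq l).
        by rewrite row_mxEl !mxE => ->; rewrite eqxx eq_sym.
      by rewrite row_mxEr !mxE.
    have -> : lift (rshift n.+1 (ord0 : 'I_n.+1)) (cast_ord e (rshift n.+1 l)) =
        rshift n.+1 (lift ord0 l).
      by apply/val_inj; rewrite /= /bump addn0 leq_addr /=; lia.
    by rewrite split_rshift Hy !mxE; case: (fintype.split c) => c'; rewrite !mxE ?liftK // !mxE.
  have -> : cast_ord (esym (basis_card n.+1)) ord0 = ord0 :> 'I_(1 + n * 2).+1 by exact/val_inj.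
  rewrite unlift_none; apply/rowP => c; rewrite !mxE lift_perm_id split_rshift.
  by rewrite !mxE; case: (fintype.split c) => c'; rewrite !mxE ?unlift_none // !mxE.
rewrite row_permE detM det_perm normrM normr_sign mul1r.
have dB : \det (block_mx 1%:M C 0 B) = \det B by rewrite det_ublock det1 mul1r.
transitivity `|\det B|; first by congr `|_|; exact: dB.
(* [T] expresses the rows of [B] through those of [B0]; it is lower triangular with diagonal [r]. *)
pose T : 'M[R]_n.+1 := \matrix_(a, c) (if unlift ord0 a is Some k
  then if c == ord0 then t k else (a == c)%:R * r else (c == ord0)%:R * r).
pose B0 : 'M[R]_n.+1 := \matrix_a (if unlift ord0 a is Some k
  then delta_mx ord0 (lift j k) else xi).
have -> : B = T *m B0.
  apply/matrixP => a c; rewrite !mxE big_ord_recl !mxE unlift_none.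
  case: (unliftP ord0 a) => [k|] ->; rewrite ?liftK ?unlift_none eqxx.
    rewrite (bigD1 k) //= !mxE liftK eqxx /= mul1r big1 ?addr0; last first.
      move=> l lk; rewrite !mxE liftK /= (inj_eq lift_inj) eq_sym (negPf lk).
      by rewrite /= !mul0r.
    by rewrite !mxE addrC.
  rewrite big1 ?addr0 ?mul1r ?mxE // => l _.
  by rewrite !mxE unlift_none /= mul0r mul0r.
rewrite detM det_trig; last first.
  apply/is_trig_mxP => a c ac; rewrite mxE.
  have c0 : c != ord0 by apply/eqP => c0; rewrite c0 in ac.
  have -> : (a == c) = false by apply/eqP => e; rewrite e ltnn in ac.
  by rewrite (negPf c0) !mul0r; case: unlift.
have -> : \prod_i T i i = r ^+ n.+1.
  rewrite (eq_bigr (fun=> r)) ?prodr_const ?card_ord // => a _.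
  by rewrite mxE; case: (unliftP ord0 a) => [k|] ->; rewrite ?eqxx ?mul1r.
(* In column [j] only the row [xi] is nonzero, and the complementary minor is the identity. *)
rewrite (expand_det_col B0 j) big_ord_recl big1 ?addr0; last first.
  by move=> k _; rewrite !mxE liftK mxE eqxx (negPf (neq_lift j k)) mul0r.
rewrite mxE unlift_none /cofactor.
have -> : row' ord0 (col' j B0) = 1%:M.
  apply/matrixP => a c; rewrite !mxE liftK !mxE eqxx /= (inj_eq lift_inj).
  by rewrite eq_sym.
by rewrite det1 mulr1 !normrM xij normrX normr_sign !mulr1.
Qed.

(** * The density of the cosphere bundle *)

Lemma is_derive_coord {R : realType} {N : nat} (c : 'I_N) (a v : 'rV[R]_N) :
  is_derive a v (fun x : 'rV[R]_N => x ord0 c : R^o) (v ord0 c).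
Proof.
have H : (fun h : R => h^-1 *: (((fun x : 'rV[R]_N => x ord0 c : R^o) \o shift a) (h *: v)
     - a ord0 c)) @ 0^' --> v ord0 c.
  apply: cvg_near_cst; near=> t.
  have t0 : t != 0 by near: t; exact: nbhs_dnbhs_neq.
  by rewrite /= !mxE addrK /GRing.scale /= mulKf.
apply: DeriveDef; first by apply/cvg_ex; exists (v ord0 c).
exact: cvg_lim H.
Unshelve. all: by end_near. Qed.

(** For [s = (-1) ^+ b] this is the covector [xi] of [cosphere_param], and [s = 0] gives its
    derivative; a free [s] serves to integrate with the [j]-th coordinate outermost. *)
Definition cone_dir {R : realType} {n : nat} (j : 'I_n.+1) (s : R) (y : 'rV[R]_n) :
  'rV[R]_n.+1 := \row_k (if unlift j k is Some k' then y ord0 k' else s).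

Lemma is_derive_cone_dir {R : realType} {n : nat} (j c : 'I_n.+1) (s : R)
    (u v : 'rV[R]_(n.+1 + n)) :
  is_derive u v (fun u => cone_dir j s (rsubmx u) ord0 c : R^o)
   (cone_dir j 0 (rsubmx v) ord0 c).
Proof.
rewrite !mxE; case: (unliftP j c) => [k|] ->.
  rewrite (_ : (fun u0 => _) = fun u : 'rV[R]_(n.+1 + n) => u ord0 (rshift n.+1 k)).
    by rewrite mxE; exact: is_derive_coord.
  by apply/funext => w; rewrite mxE liftK mxE.
rewrite (_ : (fun u0 => _) = cst s); first exact: is_derive_cst.
by apply/funext => w; rewrite mxE unlift_none.
Qed.

Lemma cone_param_derive_base {R : realType} {n : nat} (j : 'I_n.+1) (s : R)
    (r : 'rV[R]_(n.+1 + n) -> R) (u v : 'rV[R]_(n.+1 + n)) :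
  derivable (fun u => row_mx (lsubmx u) (r u *: cone_dir j s (rsubmx u)) : 'rV_(n.+1 + n.+1)) u v ->
  lsubmx ('D_v (fun u => row_mx (lsubmx u) (r u *: cone_dir j s (rsubmx u))) u : 'rV_(n.+1 + n.+1))
   = lsubmx v.
Proof.
move=> H; rewrite derive_mx //; apply/rowP => c; rewrite !mxE.
rewrite (_ : (fun t => _) = fun u : 'rV[R]_(n.+1 + n) => u ord0 (lshift n c)).
  exact: (@derive_val _ _ _ _ _ _ _ (is_derive_coord _ _ _)).
by apply/funext => w; rewrite mxE split_lshift mxE.
Qed.

Lemma cone_param_derive_fibre {R : realType} {n : nat} (j : 'I_n.+1) (s : R)
    (r : 'rV[R]_(n.+1 + n) -> R^o) (u v : 'rV[R]_(n.+1 + n)) : s != 0 ->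
  derivable (fun u => row_mx (lsubmx u) (r u *: cone_dir j s (rsubmx u)) : 'rV_(n.+1 + n.+1)) u v ->
  rsubmx ('D_v (fun u => row_mx (lsubmx u) (r u *: cone_dir j s (rsubmx u))) u : 'rV_(n.+1 + n.+1))
   = r u *: cone_dir j 0 (rsubmx v) + 'D_v r u *: cone_dir j s (rsubmx u).
Proof.
move=> s0 H.
have comp c : (fun u => row_mx (lsubmx u) (r u *: cone_dir j s (rsubmx u)) ord0
      (rshift n.+1 c)) = r * (fun u => cone_dir j s (rsubmx u) ord0 c : R^o).
  by apply/funext => w; rewrite mxE split_rshift mxE.
(* The [j]-th fibre component of the map is [s * r], so dividing by [s] recovers the
   differentiability of [r]. *)
have dr : derivable r u v.
  move/derivable_mxP : (H) => /(_ ord0 (rshift n.+1 j)); rewrite comp.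
  move/(derivableZ (k := s^-1)); congr (derivable _ u v); apply/funext => w.
  transitivity (s^-1 * (r w * cone_dir j s (rsubmx w) ord0 j)); first by [].
  by rewrite mxE unlift_none mulrC mulfK.
rewrite derive_mx //; apply/rowP => c; rewrite !mxE comp.
have := is_derive_cone_dir j c s u v => -[dg vg].
rewrite deriveM // vg /GRing.scale /= !mxE; congr (_ + _); exact: mulrC.
Qed.

(** The orientation is the sign of the contraction, which is [n.+1] times the [Omega] term, so the
    product is an absolute value; [norm_det_cone_frame] evaluates it when all partial derivatives
    exist. *)
Lemma orientation_OmegaE {R : realType} {n : nat} {M : smoothManifold R n.+1}
    (L : finsler M) (i : chart M) j b u c :
  (forall (z : 'rV[R]_(n.+1 + n.+1)) v, vol_form z v =
     c * \det (\matrix_a v (cast_ord (esym (basis_card n.+1)) a))) ->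
  0 <= orientation L i j b u * Omega (cosphere_param L i j b u) (cosphere_frame L i j b u)
    <= `|c| / n.+1%:R * `|(hamiltonian_coord L i
         (row_mx (lsubmx u) (cone_dir j ((-1) ^+ b) (rsubmx u))))^-1| ^+ n.+1.
Proof.
move=> Hc; rewrite /orientation; set z := cosphere_param _ _ _ _ _.
set fr := cosphere_frame L i j b u.
have n0 : (n.+1%:R : R) != 0 by rewrite pnatr_eq0.
have -> : Omega z fr = n.+1%:R^-1 * (n.+1%:R * Omega z fr) by rewrite mulKf.
rewrite -vol_form_radial mulrCA -normrEsg Hc normrM mulrCA mulrA.
set D := `|\det _|; set r := hamiltonian_coord L i _.
have c0 : 0 <= `|c| / n.+1%:R by rewrite mulr_ge0 // invr_ge0.
rewrite mulr_ge0 //=; last exact: normr_ge0.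
apply: ler_wpM2l => //.
pose w k := if unlift (ord0 : 'I_(1 + n * 2).+1) k is Some k' then fr k' else row_mx 0 (rsubmx z).
have -> : D = `|\det (\matrix_a w (cast_ord (esym (basis_card n.+1)) a))| by [].
pose rr := fun u : 'rV[R]_(n.+1 + n) => (hamiltonian_coord L i
   (row_mx (lsubmx u) (cone_dir j ((-1) ^+ b) (rsubmx u))))^-1 : R^o.
pose e k : 'rV[R]_(n.+1 + n) := delta_mx ord0 (cast_ord (frame_card n) k).
have [good|] := pselect (forall k, derivable (cosphere_param L i j b) u (e k)); last first.
  move/existsNP => [k nk].
  suff -> : \det (\matrix_a w (cast_ord (esym (basis_card n.+1)) a)) = 0.
    by rewrite normr0 exprn_ge0.
  pose a := cast_ord (basis_card n.+1) (lift ord0 k : 'I_(n.+1 * 2)).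
  rewrite (expand_det_row _ a) big1 // => c' _.
  rewrite mxE cast_ordK /w liftK /fr /cosphere_frame /derive dvgP //.
  by rewrite mxE mul0r.
rewrite -[`|_^-1|]/(`|rr u|).
rewrite -(norm_det_cone_frame j (rr u) (cone_dir j ((-1) ^+ b) (rsubmx u))
  (fun k => 'D_(e (cast_ord (esym (frame_card n)) (rshift n.+1 k))) rr u) fr).
- rewrite le_eqVlt; apply/orP; left; apply/eqP; congr `|\det _|.
  apply/matrixP => a c'; rewrite !mxE /w /z /cosphere_param row_mxKr //.
- by rewrite mxE unlift_none normr_sign.
- move=> k; rewrite /fr /cosphere_frame.
  rewrite [LHS](cone_param_derive_base j ((-1) ^+ b) rr u); last exact: (good _).
  by rewrite cast_ordKV; apply/rowP => c'; rewrite !mxE eq_shift.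
- move=> k; rewrite /fr /cosphere_frame -[LHS]hsubmxK.
  have g := good (cast_ord (esym (frame_card n)) (rshift n.+1 k)).
  rewrite [lsubmx _](cone_param_derive_base j ((-1) ^+ b) rr u _ g).
  rewrite [rsubmx _](cone_param_derive_fibre j ((-1) ^+ b) rr u _ _ g) ?signr_eq0 //.
  congr row_mx; first by rewrite ?/e cast_ordKV; apply/rowP => c'; rewrite !mxE eq_shift andbF.
  congr (_ *: _ + _); apply/rowP => c'; rewrite /e cast_ordKV !mxE eqxx /=.
  case: (unliftP j c') => [k'|] ->.
    by rewrite !mxE eq_shift (inj_eq lift_inj) eqxx.
  by rewrite eq_liftF.
Qed.

(** * Iterated integrals *)

Definition coord_cylinders (R : realType) (N : nat) : set (set 'rV[R]_N) :=
  [set A | exists k (B : set (measurableTypeR R)),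
     measurable B /\ A = (fun x : 'rV[R]_N => x ord0 k) @^-1` B].

(** Row vectors with the product sigma-algebra: a map into them is measurable as soon as its
    coordinates are. *)
Definition mrV (R : realType) (N : nat) : measurableType (coord_cylinders R N).-sigma :=
  g_sigma_algebraType (coord_cylinders R N).

Local Open Scope ereal_scope.

Lemma measurable_coord {R : realType} {N : nat} (k : 'I_N) :
  measurable_fun [set: mrV R N] (fun x : mrV R N => (x : 'rV[R]_N) ord0 k : measurableTypeR R).
Proof. by move=> _ B mB; rewrite setTI; apply: sub_gen_smallest; exists k, B. Qed.

Lemma measurable_fun_rV {R : realType} {N : nat} {d} {T : measurableType d} (f : T -> 'rV[R]_N) :
  (forall k, measurable_fun [set: T] (fun t => f t ord0 k : measurableTypeR R)) ->
  measurable_fun [set: T] (f : T -> mrV R N).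
Proof.
move=> mf; apply: (@measurability _ _ T (mrV R N) setT f (@coord_cylinders R N)) => //.
move=> _ [_ [k [B [mB ->]]] <-].
exact: (mf k measurableT B mB).
Qed.

Definition row_cons {R : realType} {N : nat} (t : R) (y : 'rV[R]_N) : 'rV[R]_N.+1 :=
  row_mx (t%:M : 'rV[R]_1) y.

Lemma row_cons0 {R : realType} {N : nat} (t : R) (y : 'rV[R]_N) :
  row_cons t y ord0 ord0 = t.
Proof.
rewrite (_ : ord0 = lshift N (ord0 : 'I_1) :> 'I_(1 + N)); last exact/val_inj.
by rewrite [LHS]row_mxEl mxE eqxx mulr1n.
Qed.

Lemma row_consS {R : realType} {N : nat} (t : R) (y : 'rV[R]_N) (k : 'I_N) :
  row_cons t y ord0 (lift ord0 k) = y ord0 k.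
Proof.
rewrite (_ : lift ord0 k = rshift 1 k :> 'I_(1 + N)); last exact/val_inj.
by rewrite [LHS]row_mxEr.
Qed.

Lemma measurable_row_cons {R : realType} {N : nat} {d} {T : measurableType d}
    (f : T -> R) (g : T -> 'rV[R]_N) :
  measurable_fun [set: T] (f : T -> measurableTypeR R) ->
  measurable_fun [set: T] (g : T -> mrV R N) ->
  measurable_fun [set: T] (fun t => row_cons (f t) (g t) : mrV R N.+1).
Proof.
move=> mf mg; apply: (@measurable_fun_rV R N.+1) => k.
case: (unliftP ord0 k) => [i|] ->.
  under eq_fun do rewrite row_consS.
  exact: (measurableT_comp (measurable_coord i) mg).
by under eq_fun do rewrite row_cons0.
Qed.

Lemma integral_rV_ge0 {R : realType} {N : nat} (f : 'rV[R]_N -> \bar R) :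
  (forall x, 0 <= f x) -> 0 <= integral_rV f.
Proof.
elim: N f => [|N IH] f f0 /=; first exact: f0.
by apply: integral_ge0 => t _; exact: IH.
Qed.

Lemma eq_integral_rV {R : realType} {N : nat} (f g : 'rV[R]_N -> \bar R) :
  f =1 g -> integral_rV f = integral_rV g.
Proof. by move=> /funext ->. Qed.

(** Both integrals are suprema over simple functions below the integrand. This is what allows the
    cosphere density, defined through derivatives, to be bounded under the integral sign. *)
Lemma le_integral_nonmeasurable {d} {T : measurableType d} {R : realType}
    (mu : {measure set T -> \bar R}) (f g : T -> \bar R) :
  (forall x, 0 <= f x) -> (forall x, f x <= g x) ->
  \int[mu]_x f x <= \int[mu]_x g x.
Proof.
move=> f0 fg; have g0 x : 0 <= g x by exact: le_trans (f0 x) (fg x).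
rewrite !ge0_integralTE //; apply: ge_ereal_sup => _ [h hf <-].
by apply: ereal_sup_ubound; exists h => // x; exact: le_trans (hf x) (fg x).
Qed.

Lemma le_integral_rV {R : realType} {N : nat} (f g : 'rV[R]_N -> \bar R) :
  (forall x, 0 <= f x) -> (forall x, f x <= g x) -> integral_rV f <= integral_rV g.
Proof.
elim: N f g => [|N IH] f g f0 fg /=; first exact: fg.
apply: le_integral_nonmeasurable => t; first exact: integral_rV_ge0.
exact: IH.
Qed.

(** The parameter space [T] varies in the induction: the first coordinate is absorbed into it, and
    the Tonelli theorem treats the one remaining real integral. *)
Lemma measurable_integral_rV {R : realType} {N : nat} {d} {T : measurableType d}
    (f : T * mrV R N -> \bar R) :
  measurable_fun setT f -> (forall x, 0 <= f x) ->
  measurable_fun [set: T] (fun x => integral_rV (fun y => f (x, y))).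
Proof.
elim: N d T f => [|N IH] d T f mf f0 /=.
  exact: (measurable_fun_pair1 ((0%R : 'rV[R]_0) : mrV R 0) mf).
pose g (p : (T * measurableTypeR R) * mrV R N) : \bar R :=
  f (p.1.1, row_cons p.1.2 p.2).
have mg : measurable_fun [set: (T * measurableTypeR R) * mrV R N] g.
  apply: (measurableT_comp mf); apply: measurable_fun_pair.
    exact: (measurableT_comp measurable_fst measurable_fst).
  apply: measurable_row_cons.
    exact: (measurableT_comp measurable_snd measurable_fst).
  exact: measurable_snd.
have /(_ g mg) H := IH _ (T * measurableTypeR R)%type.
have g0 x : 0 <= g x by exact: f0.
apply: (@measurable_fun_fubini_tonelli_F _ _ T (measurableTypeR R) R
  (@lebesgue_measure R) (fun p => integral_rV (fun y => g (p, y)))).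
exact: H.
move=> p; exact: integral_rV_ge0.
Qed.

Lemma measurable_slice {R : realType} {N : nat} (f : mrV R N.+1 -> \bar R) :
  measurable_fun setT f ->
  measurable_fun [set: measurableTypeR R * mrV R N] (fun p => f (row_cons p.1 p.2)).
Proof.
move=> mf; apply: (measurableT_comp mf).
by apply: measurable_row_cons; [exact: measurable_fst|exact: measurable_snd].
Qed.

Lemma measurable_slice_at {R : realType} {N : nat} (f : mrV R N.+1 -> \bar R) (t : R) :
  measurable_fun setT f ->
  measurable_fun [set: mrV R N] (fun y => f (row_cons t y)).
Proof. by move=> /measurable_slice/(measurable_fun_pair2 (t : measurableTypeR R)). Qed.

Lemma measurable_integral_slice {R : realType} {N : nat} (f : mrV R N.+1 -> \bar R) :
  measurable_fun setT f -> (forall x, 0 <= f x) ->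
  measurable_fun [set: measurableTypeR R] (fun t => integral_rV (fun y => f (row_cons t y))).
Proof.
move=> mf f0.
apply: (@measurable_integral_rV _ _ _ _ (fun p => f (row_cons p.1 p.2))) => //.
exact: measurable_slice.
Qed.

Lemma integral_rVD {R : realType} {N : nat} (f g : mrV R N -> \bar R) :
  measurable_fun setT f -> measurable_fun setT g ->
  (forall x, 0 <= f x) -> (forall x, 0 <= g x) ->
  integral_rV (fun x => f x + g x) = integral_rV f + integral_rV g.
Proof.
elim: N f g => [|N IH] f g mf mg f0 g0 //=.
rewrite -ge0_integralD //.
- apply: eq_integral => t _.
  apply: (IH (fun y => f (row_cons t y)) (fun y => g (row_cons t y))) => //.
    exact: measurable_slice_at.
  exact: measurable_slice_at.
- by move=> t _; exact: integral_rV_ge0.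
- exact: measurable_integral_slice.
- by move=> t _; exact: integral_rV_ge0.
- exact: measurable_integral_slice.
Qed.

Lemma integral_rVZ {R : realType} {N : nat} (c : R) (f : mrV R N -> \bar R) :
  measurable_fun setT f -> (forall x, 0 <= f x) -> (0 <= c)%R ->
  integral_rV (fun x => c%:E * f x) = c%:E * integral_rV f.
Proof.
elim: N f => [|N IH] f mf f0 c0 //=.
rewrite -ge0_integralZl_EFin //.
- apply: eq_integral => t _.
  apply: (IH (fun y => f (row_cons t y))) => //; exact: measurable_slice_at.
- by move=> t _; exact: integral_rV_ge0.
- exact: measurable_integral_slice.
Qed.

Lemma integral_rV0 {R : realType} {N : nat} : integral_rV (fun _ : 'rV[R]_N => 0) = 0.
Proof. by elim: N => [|N IH] //=; apply: integral0_eq => t _. Qed.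

Lemma integral_rV_sum {R : realType} {N : nat} {I : Type} (s : seq I)
    (f : I -> mrV R N -> \bar R) :
  (forall i, measurable_fun setT (f i)) -> (forall i x, 0 <= f i x) ->
  integral_rV (fun x => \sum_(i <- s) f i x) = \sum_(i <- s) integral_rV (f i).
Proof.
move=> mf f0; elim: s => [|i s IH].
  by rewrite big_nil -[RHS](@integral_rV0 R N); apply: eq_integral_rV => x; rewrite big_nil.
rewrite big_cons -IH -integral_rVD //; last by move=> x; exact: sume_ge0.
  by apply: eq_integral_rV => x; rewrite big_cons.
exact: emeasurable_sum.
Qed.

(** The integral over [T] is moved inwards past one real coordinate at a time. *)
Lemma integral_rV_tonelli {R : realType} {N : nat} {d} {T : measurableType d}
    (mu : {sigma_finite_measure set T -> \bar R}) (f : T * mrV R N -> \bar R) :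
  measurable_fun setT f -> (forall x, 0 <= f x) ->
  \int[mu]_x integral_rV (fun y => f (x, y)) = integral_rV (fun y => \int[mu]_x f (x, y)).
Proof.
elim: N f => [|N IH] f mf f0 //=.
pose g (p : (T * measurableTypeR R) * mrV R N) : \bar R :=
  f (p.1.1, row_cons p.1.2 p.2).
have mg : measurable_fun [set: (T * measurableTypeR R) * mrV R N] g.
  apply: (measurableT_comp mf); apply: measurable_fun_pair.
    exact: (measurableT_comp measurable_fst measurable_fst).
  apply: measurable_row_cons.
    exact: (measurableT_comp measurable_snd measurable_fst).
  exact: measurable_snd.
have mG : measurable_fun [set: T * measurableTypeR R] (fun p => integral_rV (fun y => g (p, y))).
  exact: (measurable_integral_rV g mg (fun p => f0 _)).
rewrite [LHS](fubini_tonelli (m1 := mu) (m2 := @lebesgue_measure R) _ mG); last first.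
  by move=> p; apply: integral_rV_ge0 => y; exact: f0.
apply: eq_integral => t _.
apply: (IH (fun p => g ((p.1, t), p.2))); last by move=> p; exact: f0.
apply: (measurableT_comp mg); apply: measurable_fun_pair; last exact: measurable_snd.
by apply: measurable_fun_pair; [exact: measurable_fst|exact: measurable_cst].
Qed.

Lemma integral_rV_box {R : realType} {N : nat} (r c : R) : (0 <= r)%R -> (0 <= c)%R ->
  integral_rV (fun x : 'rV[R]_N =>
    (c * \1_[set x : 'rV[R]_N | forall k, (`|x ord0 k| <= r)%R] x)%:E) = (c * (r *+ 2) ^+ N)%:E.
Proof.
move=> r0 c0; elim: N => [|N IH] /=.
  by rewrite expr0 mulr1 indicE mem_set; [rewrite mulr1|case].
pose B : set (measurableTypeR R) := [set` `[(- r)%R, r]].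
transitivity (\int[@lebesgue_measure R]_t ((c * (r *+ 2) ^+ N)%:E * (\1_B t)%:E)).
  apply: eq_integral => t _; rewrite -IH.
  have [Bt|Bt] := pselect (B t).
    rewrite [in RHS]indicE mem_set // mule1; apply: eq_integral_rV => y.
    congr (c * _)%:E; rewrite !indicE; congr (nat_of_bool _)%:R.
    apply/idP/idP; rewrite !inE => H.
      by move=> k; have := H (lift ord0 k); rewrite row_consS.
    move=> k; case: (unliftP ord0 k) => [i|] ->; rewrite ?row_consS // row_cons0.
    by move: Bt; rewrite /B /= in_itv /= ler_norml.
  rewrite [in RHS]indicE memNset // mule0 -[RHS](@integral_rV0 R N).
  apply: eq_integral_rV => y; rewrite indicE memNset ?mulr0 // => /(_ ord0).
  by rewrite row_cons0 => H; apply: Bt; rewrite /B /= in_itv /= -ler_norml.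
rewrite ge0_integralZl_EFin; [|exact: measurableT|by move=> t _; rewrite lee_fin|apply/measurable_EFinP; apply: measurable_indic; exact: measurable_itv|by rewrite mulr_ge0 // exprn_ge0 // mulrn_wge0].
have mB : measurable B by exact: measurable_itv.
have muB : @lebesgue_measure R B = (r *+ 2)%:E.
  rewrite /B lebesgue_measure_itv /= lte_fin opprK -mulr2n; case: ltP => // H.
  by rewrite (_ : r = 0%R) ?mul0rn //; apply/eqP; rewrite eq_le r0 andbT; lra.
by rewrite integral_indic // setIT [X in _ * X]muB -EFinM exprSr mulrA.
Qed.

Lemma integral_rV_split {R : realType} {N K : nat} (F : 'rV[R]_N -> 'rV[R]_K -> \bar R) :
  integral_rV (fun z : 'rV[R]_(N + K) => F (lsubmx z) (rsubmx z)) =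
  integral_rV (fun q => integral_rV (F q)).
Proof.
elim: N F => [|N IH] F /=.
  apply: eq_integral_rV => z; congr F; apply/rowP => k; first by case: k.
  by rewrite mxE; congr (z _ _); apply/val_inj.
apply: eq_integral => t _.
rewrite -(IH (fun q => F (row_cons t q))); apply: eq_integral_rV => z; congr F.
  apply/rowP => k; rewrite [LHS]mxE; case: (unliftP ord0 k) => [i|] ->.
    rewrite row_consS [RHS]mxE.
    rewrite (_ : lshift K (lift ord0 i) = lift ord0 (lshift K i) :> 'I_(N + K).+1); last exact/val_inj.
    exact: row_consS.
  rewrite row_cons0 (_ : lshift K ord0 = ord0 :> 'I_(N + K).+1); last exact/val_inj.
  exact: row_cons0.
apply/rowP => k; rewrite [LHS]mxE [RHS]mxE.
rewrite (_ : rshift N.+1 k = lift ord0 (rshift N k) :> 'I_(N + K).+1); last exact/val_inj.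
exact: row_consS.
Qed.

(** * Rescaling, null faces and reordering of coordinates *)

Lemma preimage_scale_oc {R : realType} (c a b : R) : c != 0%R ->
  ( *%R c) @^-1` [set` `]a, b]] =
  (if (0 < c)%R then [set` `]a / c, b / c]] else [set` `[b / c, a / c[])%R.
Proof.
move=> c0; have [cp|cn] := ltP 0%R c; apply/seteqP; split => x /=; rewrite !in_itv /=.
- by move=> /andP[? ?]; rewrite ltr_pdivrMr // ler_pdivlMr // ![(x * c)%R]mulrC; apply/andP.
- by rewrite ltr_pdivrMr // ler_pdivlMr // ![(x * c)%R]mulrC.
- have {}cn : (c < 0)%R by rewrite lt_neqAle c0.
  by rewrite ltr_ndivlMr // ler_ndivrMr // ![(x * c)%R]mulrC andbC.
- have {}cn : (c < 0)%R by rewrite lt_neqAle c0.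
  by rewrite ltr_ndivlMr // ler_ndivrMr // ![(x * c)%R]mulrC andbC.
Qed.

(** The image of Lebesgue measure under multiplication by [c], rescaled by [|c|], has the right
    value on half-open intervals and is therefore Lebesgue measure. A negative [c] moves the open
    end to the other side, which does not affect lengths. *)
Lemma integral_scale {R : realType} (c : R) (f : measurableTypeR R -> \bar R) :
  c != 0%R -> measurable_fun setT f -> (forall x, 0 <= f x) ->
  \int[@lebesgue_measure R]_t f t = `|c|%:E * \int[@lebesgue_measure R]_t f (c * t)%R.
Proof.
move=> c0 mf f0.
have mc : measurable_fun [set: measurableTypeR R]
    ( *%R c : measurableTypeR R -> measurableTypeR R) by exact: mulrl_measurable.
pose k : {nonneg R} := NngNum (normr_ge0 c).
pose phi : measurableTypeR R -> measurableTypeR R := *%R c.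
pose pm : {measure set (measurableTypeR R) -> \bar R} :=
  mscale k (pushforward (@lebesgue_measure R) phi).
pose m := pm mc.
have mE A : measurable A -> @lebesgue_measure R A = m A.
  apply: lebesgue_measure_unique => _ [[a b]] /= _ <-.
  rewrite /m /mscale /= /pushforward preimage_scale_oc // lebesgue_measure_itv /=.
  have [cp|cn] := ltP 0%R c.
    rewrite lebesgue_measure_itv /= !lte_fin ltr_pdivlMr // divfK //.
    case: ifP => ab; rewrite ?mule0 // gtr0_norm // -EFinM; congr _%:E; by field.
  have {}cn : (c < 0)%R by rewrite lt_neqAle c0.
  rewrite lebesgue_measure_itv /= !lte_fin ltr_ndivrMr // divfK //.
  case: ifP => ab; rewrite ?mule0 // ltr0_norm // -EFinM; congr _%:E; by field.
rewrite (eq_measure_integral m); last by move=> A mA _; exact: mE.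
rewrite ge0_integral_mscale //; congr (_ * _).
rewrite ge0_integral_pushforward //.
Qed.

Lemma integral_rV_scale {R : realType} {N : nat} (c : R) (f : mrV R N -> \bar R) :
  (0 < c)%R -> measurable_fun setT f -> (forall x, 0 <= f x) ->
  integral_rV f = (c ^+ N)%:E * integral_rV (fun y => f (c *: (y : 'rV[R]_N))).
Proof.
move=> c0; elim: N f => [|N IH] f mf f0 /=.
  by rewrite expr0 mul1e scaler0.
have rcZ t (y : 'rV[R]_N) : (c *: (row_cons t y) = row_cons (c * t) (c *: y))%R.
  by apply/rowP => k; rewrite mxE; case: (unliftP ord0 k) => [i|] ->;
    rewrite ?row_consS ?row_cons0 // mxE.
rewrite (@integral_scale _ c) //; first last.
- by move=> t; apply: integral_rV_ge0 => y; exact: f0.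
- exact: measurable_integral_slice.
- by rewrite gt_eqF.
rewrite gtr0_norm // exprS EFinM -muleA; congr (_ * _).
rewrite -ge0_integralZl_EFin //; first last.
- by rewrite exprn_ge0 // ltW.
- apply: (@measurable_integral_slice _ _ (fun y : 'rV[R]_N.+1 => f (c *: y)%R)) => //.
  apply: (measurableT_comp mf); apply: measurable_fun_rV => k.
  under eq_fun do rewrite mxE.
  apply: measurable_funM => //; exact: measurable_coord.
- by move=> t _; apply: integral_rV_ge0 => y; exact: f0.
apply: eq_integral => t _.
rewrite (IH (fun y => f (row_cons (c * t)%R y))) //; last exact: measurable_slice_at.
by congr (_ * _); apply: eq_integral_rV => y; rewrite -[row_mx _ _]/(row_cons t y) rcZ.
Qed.

(** For each coordinate only the two values [1] and [-1] are exceptional. This reconciles the closed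
    cubes of [cosphere_integral] with the open cones, which are disjoint. *)
Lemma integral_rV_boundary {R : realType} {N : nat} (f g : mrV R N -> \bar R) :
  measurable_fun setT f -> measurable_fun setT g ->
  (forall x, 0 <= f x) -> (forall x, 0 <= g x) ->
  (forall y : 'rV[R]_N, (forall k, `|y ord0 k| != 1)%R -> f y = g y) ->
  integral_rV f = integral_rV g.
Proof.
elim: N f g => [|N IH] f g mf mg f0 g0 fg /=; first by apply: fg => -[].
apply: ge0_ae_eq_integral => //.
- exact: measurable_integral_slice.
- exact: measurable_integral_slice.
- by move=> t _; exact: integral_rV_ge0.
- by move=> t _; exact: integral_rV_ge0.
exists ([set 1%R] `|` [set (- 1)%R] : set (measurableTypeR R)); split.
- by apply: measurableU; exact: measurable_set1.
- apply: null_set_setU => //; try exact: measurable_set1.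
  + exact: lebesgue_measure_set1.
  + exact: lebesgue_measure_set1.
- move=> t; apply: contra_notP => t1 _.
  apply: (IH (fun y => f (row_cons t y)) (fun y => g (row_cons t y))) => //; try exact: measurable_slice_at.
  move=> y y1; apply: fg => k; case: (unliftP ord0 k) => [i|] ->.
    by rewrite row_consS.
  rewrite row_cons0; apply/eqP => /eqP; rewrite eqr_norml ler01 andbT => /orP[]/eqP tt.
    by apply: t1; left.
  by apply: t1; right.
Qed.

Lemma cone_dir0 {R : realType} {N : nat} (t : R) (y : 'rV[R]_N) :
  cone_dir ord0 t y = row_cons t y.
Proof.
apply/rowP => k; rewrite mxE; case: (unliftP ord0 k) => [i|] ->.
  by rewrite row_consS.
by rewrite row_cons0.
Qed.

Lemma cone_dirS {R : realType} {N : nat} (j : 'I_N.+1) (s t : R) (y : 'rV[R]_N) :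
  cone_dir (lift ord0 j) t (row_cons s y) = row_cons s (cone_dir j t y).
Proof.
apply/rowP => k; rewrite mxE.
case: (unliftP ord0 k) => [i|] ->; rewrite ?row_consS ?row_cons0.
  rewrite mxE; case: (unliftP j i) => [l|] ->.
    have -> : lift ord0 (lift j l) = lift (lift ord0 j) (lift ord0 l).
      by apply/val_inj; rewrite /= /bump /=; lia.
    by rewrite liftK row_consS.
  by rewrite unlift_none.
have e : ord0 = lift (lift ord0 j) ord0 :> 'I_N.+2 by apply/val_inj.
by rewrite [in unlift _ _]e liftK row_cons0.
Qed.

Lemma measurable_cone_dir {R : realType} {N : nat} (j : 'I_N.+1) {d} {T : measurableType d}
    (s : T -> R) (y : T -> 'rV[R]_N) :
  measurable_fun [set: T] (s : T -> measurableTypeR R) ->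
  measurable_fun [set: T] (y : T -> mrV R N) ->
  measurable_fun [set: T] (fun t => cone_dir j (s t) (y t) : mrV R N.+1).
Proof.
move=> ms my; apply: (@measurable_fun_rV R N.+1) => k.
under eq_fun do rewrite mxE.
case: (unliftP j k) => [l|] _ //.
exact: (measurableT_comp (measurable_coord l) my).
Qed.

(** Brings the [j]-th coordinate outermost, where it can play the part of a radius. *)
Lemma integral_rV_insert {R : realType} {N : nat} (j : 'I_N.+1) (f : mrV R N.+1 -> \bar R) :
  measurable_fun setT f -> (forall x, 0 <= f x) ->
  integral_rV f = \int[@lebesgue_measure R]_t integral_rV (fun y : 'rV[R]_N => f (cone_dir j t y)).
Proof.
elim: N j f => [|N IH] j f mf f0; case: (unliftP ord0 j) => [i|] ->; try by case: i.
- by apply: eq_integral => t _ /=; rewrite cone_dir0.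
- transitivity (\int[@lebesgue_measure R]_s \int[@lebesgue_measure R]_t
    integral_rV (fun y : 'rV[R]_N => f (row_cons s (cone_dir i t y)))).
    apply: eq_integral => s _.
    by apply: (IH i (fun x => f (row_cons s x))) => //; exact: measurable_slice_at.
  pose g (p : (measurableTypeR R * measurableTypeR R) * mrV R N) :=
    f (row_cons p.1.1 (cone_dir i p.1.2 p.2)).
  have mg : measurable_fun setT g.
    apply: (measurableT_comp mf); apply: measurable_row_cons.
      exact: (measurableT_comp measurable_fst measurable_fst).
    apply: measurable_cone_dir; last exact: measurable_snd.
    exact: (measurableT_comp measurable_snd measurable_fst).
  have mG := measurable_integral_rV g mg (fun p => f0 _).
  rewrite [LHS](fubini_tonelli (m1 := @lebesgue_measure R) (m2 := @lebesgue_measure R) _ mG); last first.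
    by move=> p; apply: integral_rV_ge0 => y; exact: f0.
  apply: eq_integral => t _ /=; apply: eq_integral => s _.
  by apply: eq_integral_rV => y; rewrite -[row_mx _ _]/(row_cons s y) cone_dirS.
- apply: eq_integral => t _.
  have -> : (fun y => f (cone_dir ord0 t y)) = (fun y : 'rV[R]_N.+1 => f (row_cons t y)).
    by apply/funext => y; rewrite cone_dir0.
  by [].

Qed.

(* Borel sets of row vectors and the radial integral *)
Local Close Scope ereal_scope.

(** Boxes with rational corners form a countable base; [F] enumerates those contained in [A]. *)
Lemma open_measurable_rV {R : realType} {N : nat} (A : set 'rV[R]_N) :
  open A -> measurable (A : set (mrV R N)).
Proof.
move=> oA.
pose Box (ab : 'rV[rat]_N * 'rV[rat]_N) : set 'rV[R]_N :=
  [set x | forall k, ratr (ab.1 ord0 k) < x ord0 k < ratr (ab.2 ord0 k)].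
have mBox ab : measurable (Box ab : set (mrV R N)).
  rewrite (_ : Box ab = \bigcap_(k in [set: 'I_N])
     (fun x : mrV R N => (x : 'rV[R]_N) ord0 k) @^-1`
        [set` `]ratr (ab.1 ord0 k), ratr (ab.2 ord0 k)[]); last first.
    apply/seteqP; split => x /= H; first by move=> k _ /=; rewrite in_itv /=; exact: H.
    by move=> k; have := H k I; rewrite /= in_itv.
  apply: fin_bigcap_measurable => // k _.
  by rewrite -[X in measurable X]setTI; apply: measurable_coord => //; exact: measurable_itv.
pose F n : set (mrV R N) :=
  if unpickle n is Some ab then if `[< Box ab `<=` A >] then Box ab else set0 else set0.
have -> : A = \bigcup_n F n.
  apply/seteqP; split => x; last first.
    move=> [n _]; rewrite /F; case: unpickle => // ab; case: asboolP => // H /=; exact: H.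
  move=> Ax; have /nbhs_ballP[e /= e0 eA] : nbhs x A by exact: open_nbhs_nbhs.
  have Hk k : exists ab : rat * rat,
      (x ord0 k - e < ratr ab.1 < x ord0 k) && (x ord0 k < ratr ab.2 < x ord0 k + e).
    have /rat_in_itvoo[a] : x ord0 k - e < x ord0 k by rewrite ltrBlDr ltrDl.
    have /rat_in_itvoo[b] : x ord0 k < x ord0 k + e by rewrite ltrDl.
    by rewrite !in_itv /= => Hb Ha; exists (a, b); rewrite Hb Ha.
  pose ab k := sval (cid (Hk k)).
  have Hab k : (x ord0 k - e < ratr (ab k).1 < x ord0 k) && (x ord0 k < ratr (ab k).2 < x ord0 k + e).
    exact: svalP (cid (Hk k)).
  pose p : 'rV[rat]_N * 'rV[rat]_N := (\row_k (ab k).1, \row_k (ab k).2).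
  have pA : Box p `<=` A.
    move=> y Hy; apply: eA; split => // i j; rewrite ord1 /ball /=.
    have := Hy j; have := Hab j; rewrite !mxE ltr_norml => /andP[/andP[a1 a2] /andP[b1 b2]] /andP[y1 y2].
    apply/andP; split.
      by rewrite ltrBrDl -ltrBrDr opprK (lt_trans y2).
    by rewrite ltrBlDr -ltrBlDl (lt_trans a1).
  exists (pickle p) => //; rewrite /F pickleK asboolT // => k; rewrite !mxE.
  by have := Hab k => /andP[/andP[_ ->] /andP[-> _]].
apply: bigcupT_measurable => n; rewrite /F; case: unpickle => // ab; case: ifP => //.
Qed.

Lemma integral_radial {R : realType} (n : nat) (a : R) : 0 < a ->
  (\int[@lebesgue_measure R]_t (\1_[set t | (0 < t)%R && (t * a <= 1)%R] t * t ^+ n)%:E =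
  (n.+1%:R^-1 * (a^-1) ^+ n.+1)%:E)%E.
Proof.
move=> a0.
have a1 : 0 < a^-1 by rewrite invr_gt0.
have mX : measurable_fun [set` `]0, a^-1]] (fun t : R => (t ^+ n)%:E).
  by apply/measurable_EFinP; apply: measurable_funX; exact: measurable_id.
transitivity (\int[@lebesgue_measure R]_(t in [set` `]0%R, a^-1%R]]) (t ^+ n)%:E)%E.
  rewrite [RHS]integral_mkcond; apply: eq_integral => t _.
  rewrite patchE indicE.
  have -> : (t \in ([set t | (0 < t) && (t * a <= 1)] : set R)) = (t \in [set` `]0, a^-1]]).
    apply/idP/idP; rewrite !inE /= in_itv /= -[a^-1]mul1r ler_pdivlMr //.
  by case: ifP => _; rewrite ?mul1r ?mul0r.
rewrite integral_itv_obnd_cbnd //.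
rewrite (@continuous_FTC2 _ (fun t => t ^+ n) (fun t => t ^+ n.+1 * n.+1%:R^-1)) //=.
- by rewrite expr0n mul0r sube0 mulrC.
- apply: continuous_subspaceT => x; exact: exprn_continuous.
- have cF : continuous (fun t : R => t ^+ n.+1 * n.+1%:R^-1).
    by move=> x; apply: cvgM; [exact: exprn_continuous|exact: cvg_cst].
  split.
  + by move=> x _; apply: derivableM => //; exact: exprn_derivable.
  + exact/cvg_at_right_filter/cF.
  + exact/cvg_at_left_filter/cF.
- move=> x _; rewrite derive1Mr; last exact: exprn_derivable.
  by rewrite derive1E exp_derive /GRing.scale /= mulr1 mulrAC mulfV ?mul1r // pnatr_eq0.
Qed.

Lemma measurable_boolset {d} {T : measurableType d} (b : T -> bool) (A : set T) :
  A = [set x | b x] -> measurable_fun [set: T] b -> measurable A.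
Proof.
move=> -> mb; rewrite (_ : [set x | b x] = b @^-1` [set true]); last by apply/seteqP; split => x.
by rewrite -[X in measurable X]setTI; apply: mb => //.
Qed.

Lemma measurable_sublevel {R : realType} {n : nat} {d} {T : measurableType d}
   (h : 'rV[R]_n -> R) (p : T -> 'rV[R]_n) (c : R) :
  measurable_fun setT (h : mrV R n -> measurableTypeR R) ->
  measurable_fun setT (p : T -> mrV R n) ->
  measurable [set x : T | h (p x) <= c].
Proof.
move=> mh mp.
have := measurableT_comp mh mp => /(_ measurableT [set` `]-oo, c]]) /(_ (measurable_itv _)).
by rewrite setTI; congr measurable; apply/seteqP; split => x; rewrite /= in_itv.
Qed.

Lemma measurable_coord_lt {R : realType} {n : nat} {d} {T : measurableType d}
   (y : T -> 'rV[R]_n) (r : T -> R) :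
  measurable_fun setT (y : T -> mrV R n) -> measurable_fun setT (r : T -> measurableTypeR R) ->
  measurable [set x : T | forall k, `|y x ord0 k| < r x].
Proof.
move=> my mr.
rewrite (_ : [set x | _] = \bigcap_(k in [set: 'I_n]) [set x | `|y x ord0 k| < r x]); last first.
  by apply/seteqP; split => x H k; [move=> _; exact: H|exact: (H k I)].
apply: fin_bigcap_measurable => // k _.
have mk : measurable_fun setT (fun x => y x ord0 k : measurableTypeR R).
  exact: (measurableT_comp (measurable_coord k) my).
apply: (@measurable_boolset _ _ (fun x => `|y x ord0 k| < r x)) => //.
apply: measurable_fun_ltr => //.
exact: (measurableT_comp (@normr_measurable R setT) mk).
Qed.

Lemma measurable_coord_le {R : realType} {n : nat} {d} {T : measurableType d}
   (y : T -> 'rV[R]_n) (r : T -> R) :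
  measurable_fun setT (y : T -> mrV R n) -> measurable_fun setT (r : T -> measurableTypeR R) ->
  measurable [set x : T | forall k, `|y x ord0 k| <= r x].
Proof.
move=> my mr.
rewrite (_ : [set x | _] = \bigcap_(k in [set: 'I_n]) [set x | `|y x ord0 k| <= r x]); last first.
  by apply/seteqP; split => x H k; [move=> _; exact: H|exact: (H k I)].
apply: fin_bigcap_measurable => // k _.
have mk : measurable_fun setT (fun x => y x ord0 k : measurableTypeR R).
  exact: (measurableT_comp (measurable_coord k) my).
apply: (@measurable_boolset _ _ (fun x => `|y x ord0 k| <= r x)) => //.
apply: measurable_fun_ler => //.
exact: (measurableT_comp (@normr_measurable R setT) mk).
Qed.
(** Inversion is continuous off zero, and zero is a single point. *)
Lemma measurable_inv {R : realType} : measurable_fun [set: measurableTypeR R] (GRing.inv : R -> measurableTypeR R).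
Proof.
have -> : [set: measurableTypeR R] = [set x : R | x != 0] `|` [set 0].
  apply/seteqP; split => x // _ /=; case: (eqVneq x 0) => [->|]; [by right|by left].
have o : open [set x : R | x != 0] by exact: open_neq.
apply/measurable_funU; [exact: open_measurable|exact: measurable_set1|split].
  apply: open_continuous_measurable_fun => // x; rewrite inE /= => x0.
  exact: inv_continuous.
exact: measurable_fun_set1.
Qed.

(** * Polar coordinates *)

Definition open_cone {R : realType} {n : nat} (j : 'I_n.+1) (b : bool) : set 'rV[R]_n.+1 :=
  [set p | 0 < (-1) ^+ b * p ord0 j /\
    forall k, `|p ord0 (lift j k)| < (-1) ^+ b * p ord0 j].

(** Two distinct dominant components would each exceed the other in absolute value, and one
    component cannot have both signs. *)
Lemma open_cone_inj {R : realType} {n : nat} (i j : 'I_n.+1) (b c : bool) (p : 'rV[R]_n.+1) :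
  open_cone i b p -> open_cone j c p -> (i, b) = (j, c).
Proof.
have le_n (x : R) (e : bool) : (-1) ^+ e * x <= `|x|.
  by apply: le_trans (ler_norm _) _; rewrite normrM normr_sign mul1r.
move=> [pi Hi] [pj Hj]; case: (unliftP i j) => [k ji|ji].
  have [l ij] : exists l, i = lift j l.
    case: (unliftP j i) => [l ->|ij]; first by exists l.
    by have := neq_lift i k; rewrite -ji ij eqxx.
  have := Hj l; rewrite -ij => H1.
  have := lt_le_trans (lt_le_trans H1 (le_n _ _)) => /(_ _ (lexx _)) H1'.
  have := Hi k; rewrite -ji => H2.
  by have := lt_trans H1' (lt_le_trans H2 (le_n _ _)); rewrite ltxx.
move: pj; rewrite ji; move: pi; case: b {Hi} => /=; case: c {Hj} => //=;
  rewrite ?expr1 ?expr0 ?mulN1r ?mul1r => a1 a2;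
  by have := addr_gt0 a1 a2; rewrite ?addNr ?subrr ltxx.
Qed.

(** Substitute [p = t *: cone_dir j s y]: the [j]-th coordinate is [s * t], rescaling the others by
    [t] produces the Jacobian [t ^+ n], and integrating [t] up to the inverse of [h] gives the power
    [n.+1]. *)
Lemma integral_cone {R : realType} {n : nat} (h : 'rV[R]_n.+1 -> R) (j : 'I_n.+1) (b : bool) :
  measurable_fun setT (h : mrV R n.+1 -> measurableTypeR R) ->
  (forall t p, 0 < t -> h (t *: p) = t * h p) -> (forall p, p != 0 -> 0 < h p) ->
  measurable ([set p | open_cone j b p /\ h p <= 1] : set (mrV R n.+1)) /\
  integral_rV (fun y : 'rV[R]_n => (\1_[set y : 'rV[R]_n | forall k, `|y ord0 k| <= 1] y *
     (n.+1%:R^-1 * (h (cone_dir j ((-1) ^+ b) y))^-1 ^+ n.+1))%:E) =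
  integral_rV (fun p => (\1_[set p | open_cone j b p /\ h p <= 1] p)%:E).
Proof.
move=> mh hZ h0; set s := (-1) ^+ b.
have mF : measurable ([set p | open_cone j b p /\ h p <= 1] : set (mrV R n.+1)).
  have mj : measurable_fun [set: mrV R n.+1] (fun p : mrV R n.+1 => s * (p : 'rV[R]_n.+1) ord0 j : measurableTypeR R).
    by apply: measurable_funM => //; exact: measurable_coord.
  rewrite (_ : [set p | _] = [set p : mrV R n.+1 | 0 < s * (p : 'rV[R]_n.+1) ord0 j] `&`
     [set p : mrV R n.+1 | forall k, `|(\row_k (p : 'rV[R]_n.+1) ord0 (lift j k)) ord0 k| < s * (p : 'rV[R]_n.+1) ord0 j] `&`
     [set p : mrV R n.+1 | h p <= 1]); last first.
    apply/seteqP; split => p /=.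
      by move=> [[p1 p2] p3]; split => //; split => // k; rewrite mxE; exact: p2.
    by move=> [[p1 p2] p3]; split => //; split => // k; have := p2 k; rewrite mxE.
  apply: measurableI; last exact: (measurable_sublevel h (fun p : mrV R n.+1 => p) 1 mh (@measurable_id _ _ _)).
  apply: measurableI.
    apply: (@measurable_boolset _ _ (fun p : mrV R n.+1 => 0 < s * (p : 'rV[R]_n.+1) ord0 j)) => //.
    exact: measurable_fun_ltr.
  apply: measurable_coord_lt => //.
  by apply: measurable_fun_rV => k; under eq_fun do rewrite mxE; exact: measurable_coord.
split=> //.
pose F (p : 'rV[R]_n.+1) : \bar R := (\1_[set p | open_cone j b p /\ h p <= 1] p)%:E.
rewrite -[RHS]/(integral_rV F).
have mEF : measurable_fun setT (F : mrV R n.+1 -> \bar R).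
  by apply/measurable_EFinP; exact: measurable_indic.
have F0 p : (0 <= F p)%E by rewrite lee_fin.
have mxi : measurable_fun setT (fun y : mrV R n => cone_dir j s y : mrV R n.+1).
  by apply: measurable_cone_dir => //; exact: measurable_id.
have xi0 y : cone_dir j s y != 0.
  apply/eqP => /rowP /(_ j); rewrite !mxE unlift_none => /eqP; by rewrite signr_eq0.
have hxi y : 0 < h (cone_dir j s y) by exact: h0.
have mhxi : measurable_fun setT (fun y : mrV R n => h (cone_dir j s y) : measurableTypeR R).
  exact: (measurableT_comp mh mxi).
have mI (A : set (mrV R n)) (g : mrV R n -> R) : measurable A ->
  measurable_fun setT (g : _ -> measurableTypeR R) ->
  measurable_fun setT (fun y : mrV R n => (\1_A y * g y)%:E).
  move=> mA mg; apply/measurable_EFinP; apply: measurable_funM => //.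
have mlt : measurable ([set y : mrV R n | forall k, `|(y : 'rV[R]_n) ord0 k| < 1] : set (mrV R n)).
  by apply: measurable_coord_lt => //; exact: measurable_id.
have mle : measurable ([set y : mrV R n | forall k, `|(y : 'rV[R]_n) ord0 k| <= 1] : set (mrV R n)).
  by apply: measurable_coord_le => //; exact: measurable_id.
have mg : measurable_fun setT (fun y : mrV R n =>
    n.+1%:R^-1 * (h (cone_dir j s y))^-1 ^+ n.+1 : measurableTypeR R).
  apply: measurable_funM => //; apply: measurable_funX.
  by apply: measurableT_comp mhxi; exact: measurable_inv.
have g0 y : 0 <= n.+1%:R^-1 * (h (cone_dir j s y))^-1 ^+ n.+1.
  by rewrite mulr_ge0 ?exprn_ge0 ?invr_ge0 // ltW.
transitivity (integral_rV (fun y : 'rV[R]_n => (\1_[set y : 'rV[R]_n | forall k, `|y ord0 k| < 1] y *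
     (n.+1%:R^-1 * (h (cone_dir j s y))^-1 ^+ n.+1))%:E)).
  apply: integral_rV_boundary; try exact: mI.
  - by move=> y; rewrite lee_fin mulr_ge0.
  - by move=> y; rewrite lee_fin mulr_ge0.
  - move=> y y1; congr (_ * _)%:E; rewrite !indicE; congr (nat_of_bool _)%:R.
    apply/idP/idP; rewrite !inE => H k; last exact: ltW.
    by rewrite lt_neqAle y1 H.
(* The integrand in polar coordinates: [p.1] is the radius and [p.2] the ray. *)
pose K (p : measurableTypeR R * mrV R n) : \bar R :=
  (\1_[set y : 'rV[R]_n | forall k, `|y ord0 k| < 1] p.2 *
   (\1_[set t | (0 < t) && (t * h (cone_dir j s p.2) <= 1)] p.1 * p.1 ^+ n))%:E.
have K0 p : (0 <= K p)%E.
  rewrite lee_fin mulr_ge0 // indicE; case: (boolP (_ \in _)); rewrite ?mul0r // inE /=.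
  by move=> /andP[/ltW ? _]; rewrite mul1r exprn_ge0.
have mK : measurable_fun setT K.
  apply/measurable_EFinP; apply: measurable_funM.
    have m1 := @measurable_indic _ (mrV R n) R setT _ mlt.
    exact: (measurableT_comp m1 (@measurable_snd _ _ (measurableTypeR R) (mrV R n))).
  apply: measurable_funM; last by apply: measurable_funX; exact: measurable_fst.
  rewrite (_ : (fun x => _) = \1_[set p : measurableTypeR R * mrV R n | (0 < p.1) && (p.1 * h (cone_dir j s p.2) <= 1)]); last first.
    by apply/funext => p; rewrite !indicE; congr (nat_of_bool _)%:R; apply/idP/idP; rewrite !inE.
  apply: measurable_indic.
  apply: (@measurable_boolset _ _ (fun p : measurableTypeR R * mrV R n => (0 < p.1) && (p.1 * h (cone_dir j s p.2) <= 1))) => //.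
  apply: measurable_and.
    by apply: measurable_fun_ltr => //; exact: measurable_fst.
  apply: measurable_fun_ler => //; apply: measurable_funM; first exact: measurable_fst.
  exact: (measurableT_comp mhxi measurable_snd).
transitivity (integral_rV (fun y : 'rV[R]_n => \int[@lebesgue_measure R]_t K (t, y)))%E.
  apply: eq_integral_rV => y.
  rewrite EFinM -integral_radial // -ge0_integralZl_EFin //.
  - move=> t _; rewrite lee_fin indicE; case: (boolP (_ \in _)); rewrite ?mul0r // inE /=.
    by move=> /andP[/ltW ? _]; rewrite mul1r exprn_ge0.
  - apply/measurable_EFinP; apply: measurable_funM; last exact: measurable_funX.
    apply: measurable_indic.
    apply: (@measurable_boolset _ _ (fun t : measurableTypeR R => (0 < t) && (t * h (cone_dir j s y) <= 1))) => //.
    apply: measurable_and; first exact: measurable_fun_ltr.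
    by apply: measurable_fun_ler => //; apply: measurable_funM.
rewrite -integral_rV_tonelli //.
pose f (t : measurableTypeR R) := integral_rV (fun y : 'rV[R]_n => F (cone_dir j t y)).
have mf : measurable_fun setT f.
  apply: (measurable_integral_rV (fun p : measurableTypeR R * mrV R n => F (cone_dir j p.1 p.2))) => //.
  apply: (measurableT_comp mEF); apply: measurable_cone_dir; [exact: measurable_fst|exact: measurable_snd].
(* The [j]-th coordinate has the sign [s] on the cone; reflecting it makes it the positive radius
   [t]. *)
transitivity (\int[@lebesgue_measure R]_t f (s * t)%R)%E; last first.
  rewrite [RHS](integral_rV_insert j) //.
  rewrite [RHS](@integral_scale _ s) ?signr_eq0 //; last by move=> t; exact: integral_rV_ge0.
  by rewrite normr_sign mul1e.
apply: eq_integral => t _; rewrite /f.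
(* For [t <= 0] both integrands vanish identically. *)
have [t0|t0] := ltP 0 t; last first.
  rewrite [LHS](_ : _ = 0%E); last first.
    rewrite -[RHS](@integral_rV0 R n); apply: eq_integral_rV => y.
    rewrite /K /= [X in _ * (X * _)]indicE memNset ?mul0r ?mulr0 //=.
    by rewrite ltNge t0.
  rewrite -[LHS](@integral_rV0 R n); apply: eq_integral_rV => y.
  rewrite /F indicE memNset // => -[[]]; rewrite mxE unlift_none.
  by rewrite mulrA -expr2 sqrr_sign mul1r ltNge t0.
have mFt : measurable_fun setT (fun y : mrV R n => F (cone_dir j (s * t) y)).
  apply: (measurableT_comp mEF); apply: measurable_cone_dir => //; exact: measurable_id.
rewrite (integral_rV_scale t (fun y => F (cone_dir j (s * t) y)) t0 mFt) //.
rewrite -integral_rVZ ?exprn_ge0 ?(ltW t0) //; last first.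
  apply: (measurableT_comp mEF); apply: measurable_cone_dir => //.
  apply: measurable_fun_rV => k; under eq_fun do rewrite mxE.
  by apply: measurable_funM => //; exact: measurable_coord.
apply: eq_integral_rV => y.
have xit : cone_dir j (s * t) (t *: y) = t *: cone_dir j s y.
  apply/rowP => k; rewrite !mxE; case: (unlift j k) => [l|]; rewrite ?mxE //.
  by rewrite mulrC.
rewrite /K /F /= -EFinM mulrA mulrC; congr (_ * _)%:E.
rewrite !indicE -natrM mulnb; congr (nat_of_bool _)%:R.
have tj : s * (t *: cone_dir j s y) ord0 j = t.
  by rewrite !mxE unlift_none mulrCA -expr2 sqrr_sign mulr1.
have tk k : (t *: cone_dir j s y) ord0 (lift j k) = t * y ord0 k.
  by rewrite !mxE liftK.
rewrite xit; apply/idP/idP.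
  move=> /andP[]; rewrite !inE /= => y1 /andP[_ ht].
  split; last by rewrite hZ.
  split; first by rewrite tj.
  by move=> k; rewrite tj tk normrM gtr0_norm // gtr_pMr // y1.
rewrite !inE => -[[_ y1] ht]; rewrite tj in y1; apply/andP; split; rewrite inE /=.
  by move=> k; have := y1 k; rewrite tk normrM gtr0_norm // gtr_pMr.
by rewrite t0 -hZ.
Qed.

(** The cones are disjoint, so their indicators add up to at most that of the sublevel set. *)
Lemma sum_integral_cone_le {R : realType} {n : nat} (h : 'rV[R]_n.+1 -> R) :
  measurable_fun setT (h : mrV R n.+1 -> measurableTypeR R) ->
  (forall t p, 0 < t -> h (t *: p) = t * h p) -> (forall p, p != 0 -> 0 < h p) ->
  (\sum_(j < n.+1) \sum_(b : bool)
    integral_rV (fun y : 'rV[R]_n => (\1_[set y : 'rV[R]_n | forall k, (`|y ord0 k| <= 1)%R] y *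
     (n.+1%:R^-1 * (h (cone_dir j ((-1) ^+ b)%R y))^-1 ^+ n.+1))%R%:E) <=
  integral_rV (fun p => (\1_[set p | (h p <= 1)%R] p)%:E))%E.
Proof.
move=> mh hZ h0; rewrite pair_bigA.
pose F (jb : 'I_n.+1 * bool) (p : 'rV[R]_n.+1) : R := \1_[set p | open_cone jb.1 jb.2 p /\ h p <= 1] p.
rewrite (eq_bigr (fun jb => integral_rV (EFin \o F jb))); last first.
  by move=> [j b] _; have [_ ->] := integral_cone h j b mh hZ h0.
rewrite -(integral_rV_sum _ (fun jb => (EFin \o F jb : mrV R n.+1 -> \bar R))); last 2 first.
- move=> [j b]; have [mF _] := integral_cone h j b mh hZ h0.
  by apply/measurable_EFinP; exact: measurable_indic.
- by move=> jb p; rewrite lee_fin.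
apply: (@le_integral_rV R n.+1) => p; first by apply: sume_ge0 => jb _; rewrite lee_fin.
rewrite sumEFin lee_fin.
have [[[j b] Fp]|nF] := pselect (exists jb, (open_cone jb.1 jb.2 p /\ h p <= 1)); last first.
  rewrite big1 // => jb _; rewrite /F indicE memNset // => H; by apply: nF; exists jb.
rewrite (bigD1 (j, b)) //= big1 ?addr0.
  by rewrite /F !indicE mem_set // mem_set //=; case: Fp.
move=> [j' b'] jb; rewrite /F indicE memNset // => -[/= H _]; case/eqP: jb.
by apply: open_cone_inj H _; case: Fp.
Qed.

(** * Hamiltonians in charts *)

Lemma pairingZr {R : realType} {d : nat} (p v : 'rV[R]_d) (t : R) :
  pairing p (t *: v) = t * pairing p v.
Proof. by rewrite /pairing big_distrr /=; apply: eq_bigr => k _; rewrite mxE mulrCA. Qed.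

Lemma pairingZl {R : realType} {d : nat} (p v : 'rV[R]_d) (t : R) :
  pairing (t *: p) v = t * pairing p v.
Proof. by rewrite /pairing big_distrr /=; apply: eq_bigr => k _; rewrite mxE mulrA. Qed.

Lemma pairing0r {R : realType} {d : nat} (p : 'rV[R]_d) : pairing p 0 = 0.
Proof. by rewrite -(scale0r (0 : 'rV[R]_d)) pairingZr mul0r. Qed.

Lemma pairing_mulmx {R : realType} {d : nat} (p v : 'rV[R]_d) (J : 'M[R]_d) :
  pairing (p *m J^T) v = pairing p (v *m J).
Proof.
have pE (x y : 'rV[R]_d) : pairing x y = (x *m y^T) ord0 ord0.
  by rewrite mxE; apply: eq_bigr => k _; rewrite !mxE.
by rewrite !pE trmx_mul mulmxA.
Qed.

(** * Gauges and their dual norms *)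

Definition dual_norm {R : realType} {d : nat} (N : 'rV[R]_d -> R) (p : 'rV[R]_d) : R :=
  sup [set pairing p v | v in [set v | N v <= 1]].

(** What is retained of a Finsler metric at one point. Coercivity bounds the unit ball, so the
    supremum in [dual_norm] is finite. *)
Record coercive_gauge {R : realType} {d : nat} (N : 'rV[R]_d -> R) : Prop := CoerciveGauge {
  gauge_ge0 : forall w, 0 <= N w ;
  gaugeZ : forall (t : R) w, 0 < t -> N (t *: w) = t * N w ;
  gauge_coercive : exists2 c : R, 0 < c & forall (w : 'rV[R]_d) k, c * `|w ord0 k| <= N w }.

Arguments gauge_ge0 {R d N}.
Arguments gaugeZ {R d N}.
Arguments gauge_coercive {R d N}.

Lemma gauge0 {R : realType} {d : nat} (N : 'rV[R]_d -> R) : coercive_gauge N -> N 0 = 0.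
Proof.
move=> G; have := gaugeZ G 2 0 (ltr0n _ _); rewrite scaler0 => /eqP.
by rewrite -subr_eq0 -{1}[N 0]mul1r -mulrBl mulf_eq0 => /orP[/eqP H|/eqP //]; lra.
Qed.

Lemma gauge_gt0 {R : realType} {d : nat} (N : 'rV[R]_d -> R) (w : 'rV[R]_d) :
  coercive_gauge N -> w != 0 -> 0 < N w.
Proof.
move=> G w0; have [c c0 Hc] := gauge_coercive G.
have [k wk] : exists k, w ord0 k != 0.
  by apply/existsP; apply: contraT; rewrite negb_exists => /forallP H;
    case/eqP: w0; apply/rowP => k; have := H k; rewrite negbK mxE => /eqP.
by apply: lt_le_trans (Hc w k); rewrite mulr_gt0 // normr_gt0.
Qed.

Lemma dual_norm_has_sup {R : realType} {d : nat} (N : 'rV[R]_d -> R) (p : 'rV[R]_d) :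
  coercive_gauge N -> has_sup [set pairing p v | v in [set v | N v <= 1]].
Proof.
move=> G; have [c c0 Hc] := gauge_coercive G; split.
  by exists (pairing p 0), 0 => //=; rewrite gauge0.
exists (\sum_(k < d) `|p ord0 k| * c^-1) => _ [v /= Nv <-].
apply: ler_sum => k _; apply: le_trans (ler_norm _) _.
rewrite normrM ler_wpM2l // -[c^-1]mul1r ler_pdivlMr // mulrC.
exact: le_trans (Hc v k) Nv.
Qed.

Lemma dual_norm_ge0 {R : realType} {d : nat} (N : 'rV[R]_d -> R) (p : 'rV[R]_d) :
  coercive_gauge N -> 0 <= dual_norm N p.
Proof.
move=> G; rewrite -(pairing0r p); apply: ub_le_sup.
  by have [] := dual_norm_has_sup N p G.
by exists 0 => //=; rewrite gauge0.
Qed.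

Lemma pairing_le_dual {R : realType} {d : nat} (N : 'rV[R]_d -> R) (p w : 'rV[R]_d) :
  coercive_gauge N -> pairing p w <= dual_norm N p * N w.
Proof.
move=> G; have [->|w0] := eqVneq w 0; first by rewrite pairing0r gauge0 // mulr0.
have Nw := gauge_gt0 N w G w0; rewrite -ler_pdivrMr // mulrC -pairingZr.
apply: ub_le_sup; first by have [] := dual_norm_has_sup N p G.
by exists ((N w)^-1 *: w) => //=; rewrite gaugeZ ?invr_gt0 // mulVf // gt_eqF.
Qed.

Lemma dual_norm_le {R : realType} {d : nat} (N : 'rV[R]_d -> R) (p : 'rV[R]_d) (a : R) :
  coercive_gauge N -> 0 <= a -> (forall w, pairing p w <= a * N w) -> dual_norm N p <= a.
Proof.
move=> G a0 H; apply: ge_sup; first by have [] := dual_norm_has_sup N p G.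
move=> _ [v /= Nv <-]; apply: le_trans (H v) _.
by rewrite -[leRHS]mulr1 ler_wpM2l.
Qed.

(** A superlevel set of the dual norm becomes a union over [w] of strict inequalities, each of which
    persists nearby; [w != 0] keeps away from the zero section, off which the gauge is known to be
    continuous. *)
Lemma lt_dual_normP {R : realType} {d : nat} (N : 'rV[R]_d -> R) (p : 'rV[R]_d) (a : R) :
  coercive_gauge N -> 0 <= a ->
  a < dual_norm N p <-> exists2 w, w != 0 & a * N w < pairing p w.
Proof.
move=> G a0; split=> [ap|[w w0 aw]].
  apply/not_exists2P => H; move: ap; rewrite ltNge => /negP; apply.
  apply: dual_norm_le => // w; have [->|w0] := eqVneq w 0.
    by rewrite pairing0r gauge0 // mulr0.
  by case: (H w) => // /negP; rewrite -leNgt.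
have := lt_le_trans aw (pairing_le_dual N p w G).
by rewrite ltr_pM2r // gauge_gt0.
Qed.

Lemma dual_normZ {R : realType} {d : nat} (N : 'rV[R]_d -> R) (p : 'rV[R]_d) (t : R) :
  coercive_gauge N -> 0 < t -> dual_norm N (t *: p) = t * dual_norm N p.
Proof.
move=> G t0; apply/eqP; rewrite eq_le; apply/andP; split.
  apply: dual_norm_le => //; first by rewrite mulr_ge0 ?dual_norm_ge0 // ltW.
  by move=> w; rewrite pairingZl -mulrA ler_pM2l // pairing_le_dual.
rewrite mulrC -ler_pdivlMr //; apply: dual_norm_le => //.
  by rewrite divr_ge0 ?dual_norm_ge0 // ltW.
move=> w; rewrite mulrAC ler_pdivlMr // mulrC -pairingZl; exact: pairing_le_dual.
Qed.

Lemma dual_norm_gt0 {R : realType} {d : nat} (N : 'rV[R]_d -> R) (p : 'rV[R]_d) :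
  coercive_gauge N -> p != 0 -> 0 < dual_norm N p.
Proof.
move=> G p0; apply/lt_dual_normP => //; exists p => //; rewrite mul0r /pairing.
have [k pk] : exists k, p ord0 k != 0.
  by apply/existsP; apply: contraT; rewrite negb_exists => /forallP H;
    case/eqP: p0; apply/rowP => k; have := H k; rewrite negbK mxE => /eqP.
rewrite (bigD1 k) //=; apply: ltr_pwDl; first by rewrite -expr2 exprn_even_gt0.
by apply: sumr_ge0 => l _; rewrite -expr2 sqr_ge0.
Qed.

(** * Coordinatewise continuity *)

Lemma continuous_rV {T : topologicalType} {R : realType} {N : nat} (f : T -> 'rV[R]_N) (x : T) :
  (forall k, {for x, continuous (fun t => f t ord0 k : R)}) -> {for x, continuous f}.
Proof.
move=> fk A /= /nbhs_ballP[e /= e0 eA].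
have : \forall t \near x, forall k : 'I_N, ball (f x ord0 k) e (f t ord0 k).
  apply: filter_forall => k; apply: (fk k); exact: nbhsx_ballx.
apply: filterS => t H; apply: eA; split=> // i j; rewrite ord1; exact: H.
Qed.

Lemma continuous_coordT {T : topologicalType} {R : realType} {N : nat} (f : T -> 'rV[R]_N) (x : T) k :
  {for x, continuous f} -> {for x, continuous (fun t => f t ord0 k : R)}.
Proof.
move=> fx; have H : {for f x, continuous (fun M : 'rV[R]_N => M ord0 k : R)}.
  exact: coord_continuous.
exact: (continuous_comp fx H).
Qed.

Lemma continuous_row_mx {T : topologicalType} {R : realType} {N K : nat}
    (f : T -> 'rV[R]_N) (g : T -> 'rV[R]_K) (x : T) :
  {for x, continuous f} -> {for x, continuous g} ->
  {for x, continuous (fun t => row_mx (f t) (g t))}.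
Proof.
move=> cf cg; apply: continuous_rV => k; case: (split_ordP k) => i ->.
  rewrite (_ : (fun t => _) = (fun t => f t ord0 i)); first exact: continuous_coordT.
  by apply/funext => t; rewrite row_mxEl.
rewrite (_ : (fun t => _) = (fun t => g t ord0 i)); first exact: continuous_coordT.
by apply/funext => t; rewrite row_mxEr.
Qed.

Lemma continuous_lsubmx {R : realType} {N K : nat} : continuous (@lsubmx R 1 N K).
Proof.
move=> x; apply: (@continuous_rV 'rV[R]_(N + K)) => k; have -> : (fun t : 'rV[R]_(N + K) => lsubmx t ord0 k : R) = (fun t => t ord0 (lshift K k)).
  by apply/funext => t; rewrite mxE.
exact: coord_continuous.
Qed.

Lemma continuous_rsubmx {R : realType} {N K : nat} : continuous (@rsubmx R 1 N K).
Proof.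
move=> x; apply: (@continuous_rV 'rV[R]_(N + K)) => k; have -> : (fun t : 'rV[R]_(N + K) => rsubmx t ord0 k : R) = (fun t => t ord0 (rshift N k)).
  by apply/funext => t; rewrite mxE.
exact: coord_continuous.
Qed.

(** * Transition maps and the metric read in a chart *)

Lemma img_phi {R : realType} {d : nat} {M : smoothManifold R d} (i : chart M) (x : M) :
  Defs.dom i x -> img i (phi i x).
Proof. by exists x. Qed.

Lemma dom_psi {R : realType} {d : nat} {M : smoothManifold R d} (i : chart M) q :
  img i q -> Defs.dom i (psi i q).
Proof. by move=> [x dx <-]; rewrite phiK. Qed.

Lemma psiK {R : realType} {d : nat} {M : smoothManifold R d} (i : chart M) q :
  img i q -> phi i (psi i q) = q.
Proof. by move=> [x dx <-]; rewrite phiK. Qed.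

Lemma transition_differentiable {R : realType} {d : nat} {M : smoothManifold R d} (i c : chart M) (x : M) :
  Defs.dom i x -> Defs.dom c x -> differentiable (phi c \o psi i) (phi i x).
Proof. by move=> ix cx; have [+ _] := transition_smooth i c 1; apply; exists x. Qed.

(** The two transition maps are inverse to each other near the point, so the chain rule applies to a
    composite that is locally the identity. *)
Lemma jacobian_transition {R : realType} {d : nat} {M : smoothManifold R d} (i c : chart M) (x : M) :
  Defs.dom i x -> Defs.dom c x ->
  jacobian (phi c \o psi i) (phi i x) *m jacobian (phi i \o psi c) (phi c x) = 1%:M.
Proof.
move=> ix cx; set f := phi c \o psi i; set g := phi i \o psi c.
have fp : f (phi i x) = phi c x by rewrite /f /= phiK.
have df : differentiable f (phi i x) by exact: transition_differentiable.
have dg : differentiable g (f (phi i x)) by rewrite fp; exact: transition_differentiable.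
have near_id : {near phi i x, g \o f =1 id}.
  have im : nbhs (phi i x) (img i) by apply: open_nbhs_nbhs; split; [exact: img_open|exact: img_phi].
  have dc : nbhs (phi i x) (psi i @^-1` Defs.dom c).
    apply: psi_continuous; first exact: img_phi.
    by rewrite phiK //; apply: open_nbhs_nbhs; split => //; exact: dom_open.
  apply: filterS2 im dc => q iq cq.
  by rewrite /g /f /= phiK // psiK.
have key (v : 'rV[R]_d) : v *m jacobian f (phi i x) *m jacobian g (phi c x) = v.
  rewrite -fp -!deriveEjacobian //.
  rewrite !deriveE // -[LHS]/(('d g (f (phi i x)) \o 'd f (phi i x)) v) -diff_comp //.
  rewrite -deriveE; last exact: differentiable_comp.
  by rewrite (near_eq_derive _ near_id) derive_id.
apply/row_matrixP => k; rewrite !rowE mulmx1 mulmxA; exact: key.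
Qed.

Definition gauge_coord {R : realType} {d : nat} {M : smoothManifold R d} (L : finsler M)
    (i : chart M) (q w : 'rV[R]_d) : R :=
  L (psi i q) (tan_of_chart i (psi i q) w).

Lemma tan_of_chart_neq0 {R : realType} {d : nat} {M : smoothManifold R d} (i : chart M) q w :
  img i q -> w != 0 -> tan_of_chart i (psi i q) w != 0.
Proof.
move=> iq; apply: contra_neq => H.
have := jacobian_transition i (chart_at (psi i q)) (psi i q) (dom_psi i q iq) (chart_atP _).
move: H; rewrite /tan_of_chart => H /(congr1 (mulmx w)); rewrite mulmxA.
by rewrite [w *m _]H mul0mx mulmx1 => <-.
Qed.

Lemma gauge_coord_continuous {R : realType} {d : nat} {M : smoothManifold R d} (L : finsler M)
    (i : chart M) (q w : 'rV[R]_d) : img i q -> w != 0 ->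
  {for row_mx q w, continuous (fun z : 'rV[R]_(d + d) => gauge_coord L i (lsubmx z) (rsubmx z))}.
Proof.
move=> iq w0; apply: (finsler_smooth L i 0 (row_mx q w)).
by split; rewrite /= ?row_mxKl ?row_mxKr.
Qed.

Lemma norm_coord_le {R : realType} {d : nat} (w : 'rV[R]_d) k : `|w ord0 k| <= `|w|.
Proof.
rewrite [leRHS]/Num.Def.normr /= mx_normrE.
exact: (le_bigmax _ (fun ij : 'I_1 * 'I_d => `|w ij.1 ij.2|) (ord0, k)).
Qed.

(** Coercivity: the metric is continuous and positive on the compact unit sphere, so it has a
    positive minimum there, which homogeneity extends to all vectors. *)
Lemma gauge_coordP {R : realType} {d : nat} {M : smoothManifold R d} (L : finsler M)
    (i : chart M) (q : 'rV[R]_d) : img i q -> coercive_gauge (gauge_coord L i q).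
Proof.
move=> iq.
have NZ (t : R) w : 0 < t -> gauge_coord L i q (t *: w) = t * gauge_coord L i q w.
  by move=> t0; rewrite /gauge_coord /tan_of_chart -scalemxAl finsler_homog.
split=> //; first by move=> w; exact: finsler_ge0.
pose S := [set w : 'rV[R]_d | `|w| = 1].
(* The sphere is empty only in dimension zero, where every vector is zero and any constant
   serves. *)
have [S0|S0] := pselect (S !=set0); last first.
  exists 1 => // w k; have [->|w0] := eqVneq w 0.
    by rewrite mxE normr0 mulr0; exact: finsler_ge0.
  exfalso; apply: S0; exists (`|w|^-1 *: w); rewrite /S /= normrZ normfV normr_id mulVf //.
  by rewrite normr_eq0.
have cS : compact S.
  apply: bounded_closed_compact.
    by exists 1; split => // y y1 w /= ->; exact: ltW.
  have -> : S = (fun w : 'rV[R]_d => `|w| : R) @^-1` [set 1] by [].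
  by apply: preimage_closed; [move=> w _; exact: norm_continuous|exact: closed_eq].
have [|w0 w0S Hw] := compact_EVT_min S0 cS (f := gauge_coord L i q).
  apply: continuous_in_subspaceT => w; rewrite inE => wS.
  have wn0 : w != 0 by apply/eqP => w0; move: wS; rewrite /S /= w0 normr0 => /eqP; rewrite eq_sym oner_eq0.
  have := gauge_coord_continuous L i q w iq wn0 => cg.
  have crow : {for w, continuous (fun w' : 'rV[R]_d => row_mx q w')}.
    by apply: continuous_row_mx; [exact: cst_continuous|exact: cvg_id].
  have E : (fun z : 'rV[R]_(d + d) => gauge_coord L i (lsubmx z) (rsubmx z)) \o
      (fun w' : 'rV[R]_d => row_mx q w') = gauge_coord L i q.
    by apply/funext => w'; rewrite /= row_mxKl row_mxKr.
  by rewrite -E; exact: (continuous_comp crow cg).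
exists (gauge_coord L i q w0).
  apply: finsler_gt0; apply: tan_of_chart_neq0 => //.
  by apply/eqP => w00; move: w0S; rewrite inE /S /= w00 normr0 => /eqP; rewrite eq_sym oner_eq0.
move=> w k; have [->|wn0] := eqVneq w 0.
  by rewrite mxE normr0 mulr0; exact: finsler_ge0.
have nw : 0 < `|w| by rewrite normr_gt0.
have -> : gauge_coord L i q w = `|w| * gauge_coord L i q (`|w|^-1 *: w).
  by rewrite -NZ // scalerA mulfV ?scale1r // gt_eqF.
rewrite mulrC; apply: ler_pM => //; first exact: finsler_ge0.
  exact: norm_coord_le.
apply: Hw; rewrite inE /S /= normrZ normfV normr_id mulVf //; exact: lt0r_neq0.
Qed.

(** The change of covectors is adjoint to the inverse of the change of vectors, and the latter is a
    bijection between the two unit balls. *)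
Lemma hamiltonian_coordE {R : realType} {d : nat} {M : smoothManifold R d} (L : finsler M)
    (i : chart M) (q xi : 'rV[R]_d) : img i q ->
  hamiltonian_coord L i (row_mx q xi) = dual_norm (gauge_coord L i q) xi.
Proof.
move=> iq; rewrite /hamiltonian_coord /cot_point /= row_mxKl row_mxKr /hamiltonian /dual_norm.
have J1 := jacobian_transition i (chart_at (psi i q)) (psi i q) (dom_psi i q iq) (chart_atP _).
have J2 := jacobian_transition (chart_at (psi i q)) i (psi i q) (chart_atP _) (dom_psi i q iq).
congr sup; apply/seteqP; split => _ [v /= Lv <-].
  exists (v *m jacobian (phi i \o psi (chart_at (psi i q))) (phi (chart_at (psi i q)) (psi i q))).
    by rewrite /= /gauge_coord /tan_of_chart -mulmxA J2 mulmx1.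
  by rewrite /cot_of_chart pairing_mulmx.
exists (tan_of_chart i (psi i q) v) => //.
by rewrite /cot_of_chart pairing_mulmx /tan_of_chart -mulmxA J1 mulmx1.
Qed.

(** * Lower semicontinuity and measurability of Hamiltonians *)

Lemma lsc_measurable {R : realType} {N : nat} (f : 'rV[R]_N -> R) :
  (forall x, 0 <= f x) -> (forall a, 0 <= a -> open [set x | a < f x]) ->
  measurable_fun setT (f : mrV R N -> measurableTypeR R).
Proof.
move=> f0 fo; apply: (measurability _ (RGenOInfty.measurableE R)).
move=> _ [_ [a ->] <-]; rewrite setTI.
have [a0|a0] := leP 0 a.
  have -> : f @^-1` `]a, +oo[ = [set x | a < f x].
    by apply/seteqP; split => x /=; rewrite in_itv /= andbT.
  exact: open_measurable_rV (fo a a0).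
have -> : f @^-1` `]a, +oo[ = setT; last exact: measurableT.
by apply/seteqP; split => x //= _; rewrite in_itv /= andbT; exact: lt_le_trans a0 (f0 x).
Qed.

Lemma measurable_lsubmx {R : realType} {N K : nat} :
  measurable_fun setT (fun z : mrV R (N + K) => @lsubmx R 1 N K z : mrV R N).
Proof.
apply: measurable_fun_rV => k; under eq_fun do rewrite mxE; exact: measurable_coord.
Qed.

Lemma measurable_rsubmx {R : realType} {N K : nat} :
  measurable_fun setT (fun z : mrV R (N + K) => @rsubmx R 1 N K z : mrV R K).
Proof.
apply: measurable_fun_rV => k; under eq_fun do rewrite mxE; exact: measurable_coord.
Qed.

Lemma measurable_row_mx {R : realType} {N K : nat} {d} {T : measurableType d}
    (f : T -> 'rV[R]_N) (g : T -> 'rV[R]_K) :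
  measurable_fun setT (f : T -> mrV R N) -> measurable_fun setT (g : T -> mrV R K) ->
  measurable_fun setT (fun t => row_mx (f t) (g t) : mrV R (N + K)).
Proof.
move=> mf mg; apply: measurable_fun_rV => k; case: (split_ordP k) => i ->.
  under eq_fun do rewrite row_mxEl.
  exact: (measurableT_comp (measurable_coord i) mf).
under eq_fun do rewrite row_mxEr.
exact: (measurableT_comp (measurable_coord i) mg).
Qed.

Lemma continuous_pairing {R : realType} {d : nat} (w : 'rV[R]_d) :
  continuous (fun p : 'rV[R]_d => pairing p w : R).
Proof.
move=> p; rewrite /pairing; elim: (index_enum _) => [|k s IH].
  have -> : (fun p : 'rV[R]_d => \sum_(k <- [::]) p ord0 k * w ord0 k) = (fun=> 0).
    by apply/funext => x; rewrite big_nil.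
  exact: cst_continuous.
have -> : (fun p : 'rV[R]_d => \sum_(i <- k :: s) p ord0 i * w ord0 i) =
    (fun p : 'rV[R]_d => p ord0 k * w ord0 k) + (fun p => \sum_(i <- s) p ord0 i * w ord0 i).
  by apply/funext => x; rewrite big_cons.
apply: continuousD => //; apply: continuousM; last exact: cst_continuous.
exact: coord_continuous.
Qed.

(** Off the chart image [psi i] carries no meaning. The value zero there preserves lower
    semicontinuity, the image being open and Hamiltonians nonnegative. *)
Definition ham_ext {R : realType} {d : nat} {M : smoothManifold R d} (L : finsler M)
    (i : chart M) (z : 'rV[R]_(d + d)) : R :=
  if `[< img i (lsubmx z) >] then hamiltonian_coord L i z else 0.

Lemma ham_extE {R : realType} {d : nat} {M : smoothManifold R d} (L : finsler M)
    (i : chart M) (q p : 'rV[R]_d) : img i q ->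
  ham_ext L i (row_mx q p) = dual_norm (gauge_coord L i q) p.
Proof. by move=> iq; rewrite /ham_ext row_mxKl asboolT // hamiltonian_coordE. Qed.

(** A vector [w] with [a * N w < pairing p w] at one point still satisfies this at nearby [(q, p)],
    so superlevel sets are open. *)
Lemma ham_ext_measurable {R : realType} {d : nat} {M : smoothManifold R d} (L : finsler M)
    (i : chart M) :
  measurable_fun setT (ham_ext L i : mrV R (d + d) -> measurableTypeR R).
Proof.
apply: lsc_measurable => [z|a a0].
  rewrite /ham_ext; case: asboolP => // iq.
  by rewrite -[z]hsubmxK hamiltonian_coordE // dual_norm_ge0 //; exact: gauge_coordP.
rewrite openE => z /= az; rewrite /interior.
have iq : img i (lsubmx z).
  by move: az; rewrite /ham_ext; case: asboolP => // _; rewrite ltNge a0.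
have : a < ham_ext L i (row_mx (lsubmx z) (rsubmx z)) by rewrite hsubmxK.
rewrite ham_extE // => /(lt_dual_normP _ _ _ (gauge_coordP L i _ iq) a0)[w w0 aw].
pose F (z : 'rV[R]_(d + d)) : R := pairing (rsubmx z) w - a * gauge_coord L i (lsubmx z) w.
have cF : {for z, continuous F}.
  have c1 : {for z, continuous (fun z : 'rV[R]_(d + d) => pairing (rsubmx z) w : R)}.
    exact: (continuous_comp (continuous_rsubmx z) (continuous_pairing w _)).
  have c2 : {for z, continuous (fun z : 'rV[R]_(d + d) => gauge_coord L i (lsubmx z) w : R)}.
    have crow : {for z, continuous (fun z : 'rV[R]_(d + d) => row_mx (lsubmx z) w)}.
      by apply: continuous_row_mx; [exact: continuous_lsubmx|exact: cst_continuous].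
    have E : (fun z : 'rV[R]_(d + d) => gauge_coord L i (lsubmx z) (rsubmx z)) \o
        (fun z : 'rV[R]_(d + d) => row_mx (lsubmx z) w) =
        (fun z : 'rV[R]_(d + d) => gauge_coord L i (lsubmx z) w).
      by apply/funext => w'; rewrite /= row_mxKl row_mxKr.
    by rewrite -E; exact: (continuous_comp crow (gauge_coord_continuous L i _ w iq w0)).
  have -> : F = (fun z : 'rV[R]_(d + d) => pairing (rsubmx z) w : R) -
     ((fun=> a) * (fun z : 'rV[R]_(d + d) => gauge_coord L i (lsubmx z) w : R)) by [].
  by apply: continuousB => //; apply: continuousM => //; exact: cst_continuous.
have Fz : 0 < F z by rewrite /F subr_gt0.
have n1 : \forall z' \near z, 0 < F z'.
  have o : nbhs (F z) [set y | 0 < y] by apply: open_nbhs_nbhs; split => //; exact: open_gt.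
  exact: (cF _ o).
have n2 : \forall z' \near z, img i (lsubmx z').
  have o : nbhs (lsubmx z) (img i) by apply: open_nbhs_nbhs; split => //; exact: img_open.
  exact: (continuous_lsubmx z _ o).
apply: filterS2 n1 n2 => z' F' i'.
rewrite /= -[z']hsubmxK ham_extE //; apply/lt_dual_normP => //; first exact: gauge_coordP.
by exists w => //; rewrite -subr_gt0.
Qed.

(** * The partition of unity in coordinates *)

Definition pou_ext {R : realType} {d : nat} {M : smoothManifold R d} (P : partition_of_unity M)
    (a : 'I_(pou_size P)) (q : 'rV[R]_d) : R :=
  \1_(img (pou_chart a)) q * pou_fun a (psi (pou_chart a) q).

Lemma pou_ext_ge0 {R : realType} {d : nat} {M : smoothManifold R d} (P : partition_of_unity M) a q :
  0 <= pou_ext P a q.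
Proof. by rewrite mulr_ge0 // pou_ge0. Qed.

Lemma pou_ext_le1 {R : realType} {d : nat} {M : smoothManifold R d} (P : partition_of_unity M) a q :
  pou_ext P a q <= 1.
Proof.
have i1 : \1_(img (pou_chart a)) q <= 1 :> R by rewrite indicE lern1 leq_b1.
rewrite -[leRHS]mulr1; apply: ler_pM => //; first exact: pou_ge0.
rewrite -(pou_sum1 P (psi (pou_chart a) q)) (bigD1 a) //= lerDl.
by apply: sumr_ge0 => b _; exact: pou_ge0.
Qed.

Lemma pou_ext_measurable {R : realType} {d : nat} {M : smoothManifold R d}
    (P : partition_of_unity M) a :
  measurable_fun setT (pou_ext P a : mrV R d -> measurableTypeR R).
Proof.
apply: lsc_measurable => [q|c c0]; first exact: pou_ext_ge0.
rewrite openE => q /= cq; rewrite /interior.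
have iq : img (pou_chart a) q.
  apply: contrapT => niq; move: cq; rewrite /pou_ext indicE memNset // mul0r.
  by rewrite ltNge c0.
have n1 : \forall q' \near q, c < (pou_fun a \o psi (pou_chart a)) q'.
  have o : nbhs ((pou_fun a \o psi (pou_chart a)) q) [set y : R | c < y].
    apply: open_nbhs_nbhs; split; first exact: open_gt.
    by move: cq; rewrite /pou_ext indicE mem_set // mul1r.
  exact: (pou_smooth a (pou_chart a) 0 q iq _ o).
have n2 : \forall q' \near q, img (pou_chart a) q'.
  by apply: open_nbhs_nbhs; split => //; exact: img_open.
by apply: filterS2 n1 n2 => q' c' i'; rewrite /= /pou_ext indicE mem_set // mul1r.
Qed.

(** * Volumes and the inequality *)

Definition cone_weight {R : realType} {n : nat} {M : smoothManifold R n.+1}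
    (P : partition_of_unity M) (a : 'I_(pou_size P)) (u : 'rV[R]_(n.+1 + n)) : R :=
  pou_ext P a (lsubmx u) * \1_[set y : 'rV[R]_n | forall k, `|y ord0 k| <= 1] (rsubmx u).

Definition cone_ham {R : realType} {n : nat} {M : smoothManifold R n.+1} (L : finsler M)
    (i : chart M) (j : 'I_n.+1) (b : bool) (u : 'rV[R]_(n.+1 + n)) : R :=
  ham_ext L i (row_mx (lsubmx u) (cone_dir j ((-1) ^+ b) (rsubmx u))).

Lemma pou_ext_out {R : realType} {d : nat} {M : smoothManifold R d} (P : partition_of_unity M) a q :
  ~ img (pou_chart a) q -> pou_ext P a q = 0.
Proof. by move=> niq; rewrite /pou_ext indicE memNset // mul0r. Qed.

Lemma cone_weight_ge0 {R : realType} {n : nat} {M : smoothManifold R n.+1}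
    (P : partition_of_unity M) a u : 0 <= cone_weight P a u.
Proof. by rewrite mulr_ge0 // pou_ext_ge0. Qed.

Lemma measurable_unit_cube {R : realType} {n : nat} :
  measurable ([set y : 'rV[R]_n | forall k, `|y ord0 k| <= 1] : set (mrV R n)).
Proof. by apply: measurable_coord_le => //; exact: measurable_id. Qed.

Lemma cone_weight_measurable {R : realType} {n : nat} {M : smoothManifold R n.+1}
    (P : partition_of_unity M) a :
  measurable_fun setT (cone_weight P a : mrV R (n.+1 + n) -> R).
Proof.
apply: measurable_funM.
  exact: (measurableT_comp (pou_ext_measurable P a) measurable_lsubmx).
have m1 := @measurable_indic _ (mrV R n) R setT _ measurable_unit_cube.
exact: (measurableT_comp m1 measurable_rsubmx).
Qed.

Lemma cone_ham_measurable {R : realType} {n : nat} {M : smoothManifold R n.+1} (L : finsler M)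
    (i : chart M) (j : 'I_n.+1) (b : bool) :
  measurable_fun setT (cone_ham L i j b : mrV R (n.+1 + n) -> measurableTypeR R).
Proof.
apply: (measurableT_comp (ham_ext_measurable L i)); apply: measurable_row_mx.
  exact: measurable_lsubmx.
by apply: measurable_cone_dir => //; exact: measurable_rsubmx.
Qed.

Lemma cone_ham_invX_measurable {R : realType} {n : nat} {M : smoothManifold R n.+1} (L : finsler M)
    (i : chart M) (j : 'I_n.+1) (b : bool) (m : nat) :
  measurable_fun setT (fun u : mrV R (n.+1 + n) => (cone_ham L i j b u)^-1 ^+ m : R).
Proof.
apply: measurable_funX.
exact: (measurableT_comp measurable_inv (cone_ham_measurable L i j b)).
Qed.

Lemma ham_ext_ge0 {R : realType} {d : nat} {M : smoothManifold R d} (L : finsler M)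
    (i : chart M) z : 0 <= ham_ext L i z.
Proof.
rewrite /ham_ext; case: asboolP => // iq.
by rewrite -[z]hsubmxK hamiltonian_coordE // dual_norm_ge0 //; exact: gauge_coordP.
Qed.

(** The cone inequality is applied to the dual norm on each fibre and integrated over the base. With
    [C = |c|] the right side is one chart's share of the volume. *)
Lemma polar_chart {R : realType} {n : nat} {M : smoothManifold R n.+1}
    (P : partition_of_unity M) (L : finsler M) (a : 'I_(pou_size P)) (C : R) : 0 <= C ->
  (\sum_(j < n.+1) \sum_(b : bool) integral_rV (fun u : 'rV[R]_(n.+1 + n) =>
     (cone_weight P a u * (C / n.+1%:R * (cone_ham L (pou_chart a) j b u)^-1 ^+ n.+1))%R%:E) <=
  integral_rV (fun z : 'rV[R]_(n.+1 + n.+1) =>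
     (pou_ext P a (lsubmx z) * (C * \1_[set z | ham_ext L (pou_chart a) z <= 1] z))%R%:E))%E.
Proof.
move=> C0; set i := pou_chart a.
pose G (jb : 'I_n.+1 * bool) (q : 'rV[R]_n.+1) (y : 'rV[R]_n) : \bar R :=
  (cone_weight P a (row_mx q y) * (C / n.+1%:R * (cone_ham L i jb.1 jb.2 (row_mx q y))^-1 ^+ n.+1))%R%:E.
have G0 jb q y : (0 <= G jb q y)%E.
  by rewrite lee_fin mulr_ge0 ?cone_weight_ge0 // mulr_ge0 ?divr_ge0 // exprn_ge0 // invr_ge0 ham_ext_ge0.
have mG jb : measurable_fun setT (fun p : mrV R n.+1 * mrV R n => G jb p.1 p.2).
  have mrow : measurable_fun setT (fun p : mrV R n.+1 * mrV R n => row_mx p.1 p.2 : mrV R (n.+1 + n)).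
    by apply: measurable_row_mx; [exact: measurable_fst|exact: measurable_snd].
  apply/measurable_EFinP; apply: measurable_funM.
    exact: (measurableT_comp (cone_weight_measurable P a) mrow).
  apply: measurable_funM => //.
  exact: (measurableT_comp (cone_ham_invX_measurable L i jb.1 jb.2 n.+1) mrow).
rewrite [leRHS](_ : _ = integral_rV (fun q : 'rV[R]_n.+1 => integral_rV (fun p : 'rV[R]_n.+1 =>
    (pou_ext P a q * (C * \1_[set z | ham_ext L i z <= 1] (row_mx q p)))%R%:E))); last first.
  rewrite -integral_rV_split; apply: eq_integral_rV => z; by rewrite hsubmxK.
rewrite pair_bigA.
rewrite (eq_bigr (fun jb => integral_rV (fun q => integral_rV (G jb q)))); last first.
  move=> jb _; rewrite -integral_rV_split; apply: eq_integral_rV => z; by rewrite /G hsubmxK.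
rewrite -(integral_rV_sum _ (fun jb => ((fun q => integral_rV (G jb q)) : mrV R n.+1 -> \bar R))); last 2 first.
- move=> jb; exact: (measurable_integral_rV _ (mG jb)).
- by move=> jb q; exact: integral_rV_ge0.
apply: (@le_integral_rV R n.+1) => q.
  by apply: sume_ge0 => jb _; exact: integral_rV_ge0.
have [iq|niq] := pselect (img i q); last first.
  rewrite big1 => [|jb _]; last first.
    rewrite -[RHS](@integral_rV0 R n); apply: eq_integral_rV => y.
    by rewrite /G /cone_weight row_mxKl (pou_ext_out P a q niq) !mul0r.
  by apply: (@integral_rV_ge0 R n.+1) => p; rewrite (pou_ext_out P a q niq) mul0r.
have Gq := gauge_coordP L i q iq.
pose h := dual_norm (gauge_coord L i q).
have mrow : measurable_fun setT (fun p : mrV R n.+1 => row_mx q p : mrV R (n.+1 + n.+1)).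
  by apply: measurable_row_mx => //; exact: measurable_id.
have mh : measurable_fun setT (h : mrV R n.+1 -> measurableTypeR R).
  rewrite (_ : h = (fun p => ham_ext L i (row_mx q p))); last first.
    by apply/funext => p; rewrite ham_extE.
  exact: (measurableT_comp (ham_ext_measurable L i) mrow).
have hZ t p : 0 < t -> h (t *: p) = t * h p by move=> t0; exact: dual_normZ.
have h0 p : p != 0 -> 0 < h p by move=> p0; exact: dual_norm_gt0.
have h_ge0 p : 0 <= h p by exact: dual_norm_ge0.
have := sum_integral_cone_le h mh hZ h0; rewrite pair_bigA => H.
have rC0 : 0 <= pou_ext P a q * C by rewrite mulr_ge0 // pou_ext_ge0.
have mle : measurable ([set p | h p <= 1] : set (mrV R n.+1)).
  exact: (measurable_sublevel h (fun p : mrV R n.+1 => p) 1 mh (@measurable_id _ _ _)).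
rewrite [leRHS](_ : _ = ((pou_ext P a q * C)%:E *
    integral_rV (fun p : 'rV[R]_n.+1 => (\1_[set p | (h p <= 1)%R] p)%:E))%E); last first.
  rewrite -(@integral_rVZ R n.+1) //; last first.
    by apply/measurable_EFinP; exact: measurable_indic.
  apply: eq_integral_rV => p; rewrite -EFinM mulrA; congr (_ * _)%:E.
  by rewrite !indicE; congr (nat_of_bool _)%:R; apply/idP/idP; rewrite !inE /= ham_extE.
have mcone jb : measurable_fun setT (fun y : mrV R n =>
    (\1_[set y : 'rV[R]_n | forall k, (`|y ord0 k| <= 1)%R] y *
     (n.+1%:R^-1 * (h (cone_dir jb.1 ((-1) ^+ nat_of_bool jb.2)%R y))^-1 ^+ n.+1))%R%:E).
  apply/measurable_EFinP; apply: measurable_funM.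
    exact: (@measurable_indic _ (mrV R n) R setT _ measurable_unit_cube).
  apply: measurable_funM => //; apply: measurable_funX.
  apply: (measurableT_comp measurable_inv); apply: (measurableT_comp mh).
  by apply: measurable_cone_dir => //; exact: measurable_id.
have cone0 jb (y : 'rV[R]_n) : (0 <= (\1_[set y : 'rV[R]_n | forall k, (`|y ord0 k| <= 1)%R] y *
     (n.+1%:R^-1 * (h (cone_dir jb.1 ((-1) ^+ nat_of_bool jb.2)%R y))^-1 ^+ n.+1))%R%:E)%E.
  by rewrite lee_fin mulr_ge0 // mulr_ge0 // exprn_ge0 // invr_ge0.
rewrite [leLHS](_ : _ = ((pou_ext P a q * C)%:E *
   \sum_(jb : 'I_n.+1 * bool) integral_rV (fun y : 'rV[R]_n =>
    (\1_[set y : 'rV[R]_n | forall k, (`|y ord0 k| <= 1)%R] y *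
     (n.+1%:R^-1 * (h (cone_dir jb.1 ((-1) ^+ nat_of_bool jb.2)%R y))^-1 ^+ n.+1))%R%:E))%E); last first.
  rewrite ge0_sume_distrr; last by move=> jb _; apply: integral_rV_ge0 => y; exact: cone0.
  apply: eq_bigr => jb _; rewrite -(integral_rVZ _ _ (mcone jb)) //.
  apply: eq_integral_rV => y.
  rewrite /G /cone_weight /cone_ham row_mxKl row_mxKr ham_extE // -/h -EFinM; congr _%:E.
  move: (\1_ _ y) (_ ^+ n.+1) => x z; ring.
by apply: lee_wpmul2l => //; rewrite lee_fin.
Qed.

(** * Finiteness and positivity of volumes *)

Lemma pou_support_compact {R : realType} {d : nat} {M : smoothManifold R d}
    (P : partition_of_unity M) (a : 'I_(pou_size P)) : compact [set: M] ->
  exists K : set 'rV[R]_d, [/\ compact K, K `<=` img (pou_chart a) &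
    forall q, pou_ext P a q != 0 -> K q].
Proof.
move=> cM; pose S := closure [set x | pou_fun a x != 0].
(* Here compactness of [M] enters: closed supports are compact and lie inside their charts. *)
have cS : compact S by apply: (subclosed_compact _ cM) => //; exact: closed_closure.
exists (phi (pou_chart a) @` S); split.
- apply: continuous_compact => //; apply: continuous_in_subspaceT => x; rewrite inE => Sx.
  by apply: phi_continuous; exact: (pou_supp Sx).
- by move=> _ [x Sx <-]; apply: img_phi; exact: (pou_supp Sx).
- move=> q; rewrite /pou_ext indicE.
  have [iq|niq] := pselect (img (pou_chart a) q); last by rewrite memNset // mul0r eqxx.
  rewrite mem_set // mul1r => q0; exists (psi (pou_chart a) q); last by rewrite psiK.
  exact: subset_closure.
Qed.

Lemma compact_coord_bounded {R : realType} {d : nat} (K : set 'rV[R]_d) : compact K ->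
  exists2 B : R, 0 <= B & forall q k, K q -> `|q ord0 k| <= B.
Proof.
move=> cK; have /ex_strict_bound_gt0[B B0 HB] := compact_bounded cK.
exists B; first exact: ltW.
move=> q k Kq; apply: le_trans (norm_coord_le q k) _; exact: ltW (HB q Kq).
Qed.

Lemma compact_fun_bounded {R : realType} {d : nat} (K : set 'rV[R]_d) (f : 'rV[R]_d -> R) :
  compact K -> (forall q, K q -> {for q, continuous f}) ->
  exists2 B : R, 0 <= B & forall q, K q -> f q <= B.
Proof.
move=> cK cf; have [K0|K0] := pselect (K !=set0); last first.
  by exists 0 => // q Kq; exfalso; apply: K0; exists q.
have [|c _ Hc] := compact_EVT_max K0 cK (f := f).
  by apply: continuous_in_subspaceT => q; rewrite inE; exact: cf.
exists `|f c| => // q Kq; apply: le_trans (ler_norm _); by apply: Hc; rewrite inE.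
Qed.

(* [L] is bounded on the coordinate directions over the compact support, so
   the codisc bundle over it is bounded by testing covectors on them. *)
Lemma vol_chart_bounded {R : realType} {n : nat} {M : smoothManifold R n.+1}
    (P : partition_of_unity M) (L : finsler M) (a : 'I_(pou_size P)) : compact [set: M] ->
  exists2 B : R, 0 <= B & forall z : 'rV[R]_(n.+1 + n.+1), pou_ext P a (lsubmx z) != 0 ->
     ham_ext L (pou_chart a) z <= 1 -> forall k, `|z ord0 k| <= B.
Proof.
move=> cM; set i := pou_chart a.
have [K [cK Ki Kq]] := pou_support_compact P a cM.
have [B1 B10 HB1] := compact_coord_bounded K cK.
(* Both signs of each basis vector are tested, since [L] may take different values on opposite
   vectors. *)
pose e (kb : 'I_n.+1 * bool) : 'rV[R]_n.+1 := (-1) ^+ kb.2 *: delta_mx ord0 kb.1.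
have e0 kb : e kb != 0.
  apply/eqP => /rowP /(_ kb.1) /eqP; rewrite !mxE !eqxx mulr1 signr_eq0 //.
have bnd kb : exists B : R, 0 <= B /\ forall q, K q -> gauge_coord L i q (e kb) <= B.
  have [|B B0 HB] := compact_fun_bounded K (fun q => gauge_coord L i q (e kb)) cK.
    move=> q Kq'; have crow : {for q, continuous (fun q : 'rV[R]_n.+1 => row_mx q (e kb))}.
      by apply: continuous_row_mx; [exact: cvg_id|exact: cst_continuous].
    have E : (fun z : 'rV[R]_(n.+1 + n.+1) => gauge_coord L i (lsubmx z) (rsubmx z)) \o
        (fun q : 'rV[R]_n.+1 => row_mx q (e kb)) = (fun q => gauge_coord L i q (e kb)).
      by apply/funext => w'; rewrite /= row_mxKl row_mxKr.
    by rewrite -E; exact: (continuous_comp crow (gauge_coord_continuous L i q _ (Ki _ Kq') (e0 kb))).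
  by exists B.
pose B2 kb := sval (cid (bnd kb)).
have B20 kb : 0 <= B2 kb by have [] := svalP (cid (bnd kb)).
have HB2 kb q : K q -> gauge_coord L i q (e kb) <= B2 kb.
  by have [_] := svalP (cid (bnd kb)); apply.
have sB kb : B2 kb <= \sum_kb B2 kb.
  by rewrite (bigD1 kb) //= lerDl; apply: sumr_ge0.
exists (B1 + \sum_kb B2 kb); first by rewrite addr_ge0 // sumr_ge0.
move=> z /Kq Kz hz k; case: (split_ordP k) => l ->.
  apply: (@le_trans _ _ B1); last by rewrite lerDl sumr_ge0.
  by have := HB1 _ l Kz; rewrite mxE.
have iq := Ki _ Kz.
move: hz; rewrite -{1}[z]hsubmxK ham_extE // => hz.
have Hb b : (-1) ^+ nat_of_bool b * z ord0 (rshift n.+1 l) <= B1 + \sum_kb B2 kb.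
  apply: (@le_trans _ _ (gauge_coord L i (lsubmx z) (e (l, b)))); last first.
    by apply: le_trans (HB2 _ _ Kz) _; apply: le_trans (sB _) _; rewrite lerDr.
  have -> : (-1) ^+ nat_of_bool b * z ord0 (rshift n.+1 l) = pairing (rsubmx z) (e (l, b)).
    rewrite /e pairingZr; congr (_ * _); rewrite /pairing (bigD1 l) //= big1 ?addr0.
      by rewrite !mxE !eqxx mulr1.
    by move=> k' kl; rewrite !mxE eqxx (negPf kl) mulr0.
  apply: le_trans (pairing_le_dual _ _ _ (gauge_coordP L i _ iq)) _.
  by rewrite -[leRHS]mul1r ler_wpM2r //; exact: finsler_ge0.
rewrite ler_norml; apply/andP; split.
  by have := Hb true; rewrite expr1 mulN1r lerNl.
by have := Hb false; rewrite expr0 mul1r.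
Qed.

(** Without finiteness [fine] could turn an infinite volume into zero, and [cot_volume] would bound
    nothing from above. *)
Lemma vol_chart_fin {R : realType} {n : nat} {M : smoothManifold R n.+1}
    (P : partition_of_unity M) (L : finsler M) (a : 'I_(pou_size P)) (C : R) :
  compact [set: M] -> 0 <= C ->
  (integral_rV (fun z : 'rV[R]_(n.+1 + n.+1) =>
     (pou_ext P a (lsubmx z) * (C * \1_[set z | (ham_ext L (pou_chart a) z <= 1)%R] z))%R%:E) < +oo)%E.
Proof.
move=> cM C0; have [B B0 HB] := vol_chart_bounded P L a cM.
apply: (@le_lt_trans _ _ (integral_rV (fun z : 'rV[R]_(n.+1 + n.+1) =>
    (C * \1_[set x : 'rV[R]_(n.+1 + n.+1) | forall k, (`|x ord0 k| <= B)%R] z)%R%:E))%E).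
  apply: (@le_integral_rV R (n.+1 + n.+1)) => z; rewrite lee_fin.
    by rewrite mulr_ge0 ?pou_ext_ge0 // mulr_ge0.
  have [->|p0] := eqVneq (pou_ext P a (lsubmx z)) 0; first by rewrite mul0r mulr_ge0.
  rewrite mulrCA ler_wpM2l //.
  set A := [set z | _]; set D := [set x | _].
  have [Az|Az] := pselect (A z); last first.
    have -> : \1_A z = 0 :> R by rewrite indicE memNset.
    by rewrite mulr0.
  have -> : \1_A z = 1 :> R by rewrite indicE mem_set.
  have -> : \1_D z = 1 :> R by rewrite indicE mem_set //; exact: HB.
  by rewrite mulr1 pou_ext_le1.
by rewrite integral_rV_box // ltry.
Qed.

(** The ball lies in the cube of half-side [1], so its volume is finite, and contains the cube of
    half-side [1/(d+1)]. Positivity lets the normalisation cancel in the ratio of the two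
    Holmes-Thompson volumes. *)
Lemma ball_volume_gt0 {R : realType} (d : nat) : 0 < ball_volume R d.
Proof.
rewrite /ball_volume; set I := integral_rV _.
have I0 : (0 <= I)%E by apply: integral_rV_ge0 => x; rewrite lee_fin.
have mono (A B : set 'rV[R]_d) (x : 'rV[R]_d) : A `<=` B -> \1_A x <= \1_B x :> R.
  move=> AB; have [Ax|Ax] := pselect (A x); last by rewrite indicE memNset.
  by rewrite !indicE !mem_set //; exact: AB.
have up : (I <= (1 * (1 *+ 2) ^+ d)%:E)%E.
  rewrite -(@integral_rV_box R d 1 1) //; apply: le_integral_rV => x; rewrite lee_fin // mul1r.
  apply: mono => y /= Hy k; rewrite -(ler_pXn2r (ltn0Sn 1)) ?nnegrE // expr1n.
  rewrite real_normK ?num_real //; apply: le_trans Hy.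
  by rewrite (bigD1 k) //= lerDl; apply: sumr_ge0 => l _; exact: sqr_ge0.
have r0 : 0 < (d.+1%:R : R)^-1 by rewrite invr_gt0.
have low : ((1 * (d.+1%:R^-1 *+ 2) ^+ d)%:E <= I)%E.
  rewrite -(@integral_rV_box R d d.+1%:R^-1 1) ?(ltW r0) //.
  apply: le_integral_rV => x; rewrite lee_fin mul1r //.
  apply: mono => y /= Hy.
  apply: (@le_trans _ _ (\sum_(k < d) d.+1%:R^-1)).
    apply: ler_sum => k _; rewrite -real_normK ?num_real //.
    apply: (@le_trans _ _ (`|y ord0 k| * 1)); last by rewrite mulr1.
    rewrite expr2 ler_wpM2l //; apply: le_trans (Hy k) _.
    by rewrite invf_le1 ?ler1n.
  rewrite sumr_const card_ord -[_ *+ d]mulr_natl ler_pdivrMr // mul1r ler_nat //.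
apply: lt_le_trans (_ : 1 * (d.+1%:R^-1 *+ 2) ^+ d <= _).
  by rewrite mul1r exprn_gt0 // pmulrn_lgt0.
by rewrite -lee_fin fineK // fin_numE; apply/andP; split;
  [rewrite gt_eqF // (lt_le_trans _ I0)|rewrite lt_eqF // (le_lt_trans up) // ltry].
Qed.

(** * The weighted AM-GM inequality and its optimisation *)

Lemma weighted_AMGM {R : realType} (n k m : nat) (x y : R) : (k + m = n.+1)%N ->
  0 <= x -> 0 <= y -> x ^+ k * y ^+ m <= (k%:R * x ^+ n.+1 + m%:R * y ^+ n.+1) / n.+1%:R.
Proof.
move=> km x0 y0.
(* AM-GM is applied to [k] copies of [x ^+ n.+1] and [m] copies of [y ^+ n.+1]; a root of order
   [n.+1] is then taken on both sides. *)
pose E (i : 'I_n.+1) := if (i < k)%N then x ^+ n.+1 else y ^+ n.+1.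
have E0 i : 0 <= E i by rewrite /E; case: ifP => _; rewrite exprn_ge0.
have cnt (b c : R) : (\sum_(i < n.+1) (if (i < k)%N then b else c) = k%:R * b + m%:R * c).
  rewrite -km big_split_ord /=; congr (_ + _).
    rewrite (eq_bigr (fun=> b)) ?sumr_const ?card_ord ?mulr_natl // => i _.
    by rewrite ltn_ord.
  rewrite (eq_bigr (fun=> c)) ?sumr_const ?card_ord ?mulr_natl // => i _.
  by rewrite ltnNge leq_addr.
have cntp (b c : R) : (\prod_(i < n.+1) (if (i < k)%N then b else c) = b ^+ k * c ^+ m).
  rewrite -km big_split_ord /=; congr (_ * _).
    rewrite (eq_bigr (fun=> b)) ?prodr_const ?card_ord // => i _; by rewrite ltn_ord.
  by rewrite (eq_bigr (fun=> c)) ?prodr_const ?card_ord // => i _; rewrite ltnNge leq_addr.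
have := (leif_AGM (A := 'I_n.+1) (E := E) (fun i _ => E0 i)).1.
rewrite card_ord cnt cntp => H.
rewrite -(ler_pXn2r (ltn0Sn n)) ?nnegrE ?mulr_ge0 ?exprn_ge0 ?invr_ge0 ?addr_ge0 ?mulr_ge0 ?exprn_ge0 //.
by rewrite exprMn -!exprM mulnC (mulnC m) !exprM.
Qed.

(** With [s] and [t] the inverse roots of order [n.+1] of [U] and [V], the right side becomes
    [(k + m) / n.+1 = 1]. *)
Lemma optimize_AMGM {R : realType} (n k m : nat) (X U V : R) : (k + m = n.+1)%N ->
  0 <= X -> 0 < U -> 0 <= V ->
  (forall s t, 0 < s -> 0 < t ->
     s ^+ k * t ^+ m * X <= (k%:R * s ^+ n.+1 * U + m%:R * t ^+ n.+1 * V) / n.+1%:R) ->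
  X ^+ n.+1 <= U ^+ k * V ^+ m.
Proof.
move=> km X0 U0 V0 H.
have n0 : (n.+1%:R : R) != 0 by rewrite pnatr_eq0.
(* For [V = 0] the optimal [t] escapes to infinity. The case [m = 0] is separate because
   [0 ^+ 0 = 1]. *)
have [V00|Vn0] := eqVneq V 0.
  rewrite V00 in H *; case: m km H => [|m] km H.
    rewrite addn0 in km; rewrite km expr0 mulr1.
    have := H 1 1 ltr01 ltr01; rewrite !expr1n !mul1r !mulr0 addr0 mulr1 km mulrAC mulfV // mul1r => XU.
    by rewrite ler_pXn2r ?nnegrE // ltW.
  rewrite expr0n mulr0.
  suff -> : X = 0 by rewrite expr0n.
  apply/eqP; rewrite eq_le X0 andbT leNgt; apply/negP => Xp.
  (* Chosen so that [t * X = U + X] exceeds [U], while [t >= 1] gives [t <= t ^+ m.+1]. *)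
  pose t := U / X + 1.
  have t1 : 1 <= t by rewrite lerDr divr_ge0 // ltW.
  have := H 1 t ltr01 (lt_le_trans ltr01 t1).
  rewrite !expr1n !mul1r !mulr0 addr0 mulr1 => HH.
  have : t * X <= U.
    apply: le_trans (_ : t ^+ m.+1 * X <= _).
      by rewrite ler_wpM2r // exprS ler_peMr ?(le_trans ler01) // exprn_ege1.
    apply: le_trans HH _; rewrite ler_pdivrMr ?ltr0n // mulrC ler_wpM2l ?ltW //.
    by rewrite ltr_nat -km -addSnnS leq_addr.
  by rewrite mulrDl divfK ?gt_eqF // mul1r gerDl leNgt Xp.
have Vp : 0 < V by rewrite lt_neqAle eq_sym Vn0.
pose rt (x : R) := (x `^ n.+1%:R^-1)^-1.
have rt0 x : 0 < x -> 0 < rt x by move=> x0; rewrite invr_gt0 powR_gt0.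
have rtX x : 0 < x -> rt x ^+ n.+1 = x^-1.
  by move=> x0; rewrite exprVn -powR_mulrn ?powR_ge0 // -powRrM mulVf // powRr1 // ltW.
have := H (rt U) (rt V) (rt0 _ U0) (rt0 _ Vp).
rewrite !rtX // -!mulrA !mulVf ?gt_eqF // !mulr1 -natrD km mulfV // mulrA => H1.
have r0 : 0 <= rt U ^+ k * rt V ^+ m by rewrite mulr_ge0 // exprn_ge0 // ltW // rt0.
have : (rt U ^+ k * rt V ^+ m * X) ^+ n.+1 <= 1.
  by rewrite exprn_ile1 // mulr_ge0.
rewrite !exprMn -!exprM mulnC (mulnC m) !exprM !rtX // !exprVn -invfM mulrC.
by rewrite ler_pdivrMr ?mul1r // mulr_gt0 // exprn_gt0.
Qed.

(** * Comparison of the integrals chart by chart *)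

Lemma cot_volumeE {R : realType} {n : nat} {M : smoothManifold R n.+1}
    (P : partition_of_unity M) (L : finsler M) (c : R) :
  (forall (z : 'rV[R]_(n.+1 + n.+1)) v, vol_form z v =
     c * \det (\matrix_a v (cast_ord (esym (basis_card n.+1)) a))) ->
  cot_volume P (Dstar L) = fine (\sum_(a < pou_size P)
    integral_rV (fun z : 'rV[R]_(n.+1 + n.+1) =>
     (pou_ext P a (lsubmx z) * (`|c| * \1_[set z | (ham_ext L (pou_chart a) z <= 1)%R] z))%R%:E))%E.
Proof.
move=> Hc; rewrite /cot_volume; congr fine; apply: eq_bigr => a _; apply: eq_integral_rV => z.
have -> : `|vol_form z (fun k => delta_mx ord0 (cast_ord (basis_card n.+1) k))| = `|c|.
  rewrite Hc (_ : \matrix_a _ = 1%:M) ?det1 ?mulr1 //.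
  by apply/matrixP => i j; rewrite !mxE cast_ordKV eqxx eq_sym.
congr _%:E; set i := pou_chart a.
have [iq|niq] := pselect (img i (lsubmx z)); last first.
  by rewrite (pou_ext_out P a _ niq) mul0r indicE memNset ?mul0r // => -[].
rewrite /pou_ext [X in _ = X * _ * _]indicE mem_set // mul1r mulrC -mulrA; congr (_ * (_ * _)).
rewrite !indicE; congr (nat_of_bool _)%:R.
by apply/idP/idP; rewrite !inE /Dstar /= /ham_ext asboolT // => -[].
Qed.

(** Pointwise AM-GM at [s / H0] and [t / H]. The parameters stay free because their optimal values
    depend on the total volumes, not on one chart. *)
Lemma AMGM_chart {R : realType} {n : nat} {M : smoothManifold R n.+1}
    (P : partition_of_unity M) (L L0 : finsler M) (a : 'I_(pou_size P)) (j : 'I_n.+1) (b : bool)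
    (C s t : R) (k m : nat) : (k + m = n.+1)%N -> 0 <= C -> 0 < s -> 0 < t ->
  ((s ^+ k * t ^+ m)%:E * integral_rV (fun u : 'rV[R]_(n.+1 + n) =>
     (cone_weight P a u * (C / n.+1%:R * ((cone_ham L0 (pou_chart a) j b u)^-1 ^+ k *
        (cone_ham L (pou_chart a) j b u)^-1 ^+ m)))%R%:E) <=
   (k%:R * s ^+ n.+1 / n.+1%:R)%:E * integral_rV (fun u : 'rV[R]_(n.+1 + n) =>
     (cone_weight P a u * (C / n.+1%:R * (cone_ham L0 (pou_chart a) j b u)^-1 ^+ n.+1))%R%:E) +
   (m%:R * t ^+ n.+1 / n.+1%:R)%:E * integral_rV (fun u : 'rV[R]_(n.+1 + n) =>
     (cone_weight P a u * (C / n.+1%:R * (cone_ham L (pou_chart a) j b u)^-1 ^+ n.+1))%R%:E))%E.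
Proof.
move=> km C0 s0 t0; set i := pou_chart a.
have w0 u := cone_weight_ge0 P a u.
have h0 K u : 0 <= (cone_ham K i j b u)^-1 by rewrite invr_ge0 ham_ext_ge0.
have mh K l := cone_ham_invX_measurable K i j b l.
have mF (g : mrV R (n.+1 + n) -> R) : measurable_fun setT g ->
    measurable_fun setT (fun u : mrV R (n.+1 + n) => (cone_weight P a u * (C / n.+1%:R * g u))%:E).
  move=> mg; apply/measurable_EFinP; apply: measurable_funM; first exact: cone_weight_measurable.
  exact: measurable_funM.
have F0 (g : mrV R (n.+1 + n) -> R) : (forall u, 0 <= g u) ->
    forall u, (0 <= (cone_weight P a u * (C / n.+1%:R * g u))%:E)%E.
  by move=> g0 u; rewrite lee_fin mulr_ge0 // mulr_ge0 // divr_ge0.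
have e0 (x : R) l : 0 < x -> 0 <= x ^+ l by move=> ?; rewrite exprn_ge0 // ltW.
pose gY u := (cone_ham L0 i j b u)^-1 ^+ n.+1; pose gZ u := (cone_ham L i j b u)^-1 ^+ n.+1.
pose gX u := (cone_ham L0 i j b u)^-1 ^+ k * (cone_ham L i j b u)^-1 ^+ m.
have gY0 u : 0 <= gY u by rewrite exprn_ge0.
have gZ0 u : 0 <= gZ u by rewrite exprn_ge0.
have gX0 u : 0 <= gX u by rewrite mulr_ge0 // exprn_ge0.
have mY : measurable_fun setT (gY : mrV R (n.+1 + n) -> R) by exact: mh.
have mZ : measurable_fun setT (gZ : mrV R (n.+1 + n) -> R) by exact: mh.
have mX : measurable_fun setT (gX : mrV R (n.+1 + n) -> R) by exact: measurable_funM.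
have s1 : 0 <= k%:R * s ^+ n.+1 / n.+1%:R by rewrite divr_ge0 // mulr_ge0 // e0.
have t1 : 0 <= m%:R * t ^+ n.+1 / n.+1%:R by rewrite divr_ge0 // mulr_ge0 // e0.
have st0 : 0 <= s ^+ k * t ^+ m by rewrite mulr_ge0 // e0.
rewrite -(integral_rVZ _ _ (mF gX mX) (F0 gX gX0) st0).
rewrite -(integral_rVZ _ _ (mF gY mY) (F0 gY gY0) s1) -(integral_rVZ _ _ (mF gZ mZ) (F0 gZ gZ0) t1).
rewrite -(@integral_rVD R (n.+1 + n)); first last.
- by move=> u; apply: mule_ge0; [rewrite lee_fin|exact: F0].
- by move=> u; apply: mule_ge0; [rewrite lee_fin|exact: F0].
- by apply: measurable_funeM; exact: mF.
- by apply: measurable_funeM; exact: mF.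
apply: (@le_integral_rV R (n.+1 + n)) => u.
  by apply: mule_ge0; [rewrite lee_fin|exact: F0].
rewrite /gX /gY /gZ.
rewrite -!EFinM -EFinD lee_fin.
have A0 : 0 <= cone_weight P a u * (C / n.+1%:R) by rewrite mulr_ge0 // divr_ge0.
have := weighted_AMGM n k m (s * (cone_ham L0 i j b u)^-1) (t * (cone_ham L i j b u)^-1) km
  (mulr_ge0 (ltW s0) (h0 L0 u)) (mulr_ge0 (ltW t0) (h0 L u)).
move=> /(ler_wpM2l A0); rewrite !exprMn.
move: (cone_weight P a u) (_^-1 ^+ k) (_^-1 ^+ m) (_^-1 ^+ n.+1) (_^-1 ^+ n.+1) => w x y p q.
move: (s ^+ k) (t ^+ m) (s ^+ n.+1) (t ^+ n.+1) (C / n.+1%:R) => sk tm sn tn C'.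
by congr (_ <= _); ring.
Qed.

(** At the point [xi / H0 xi] of the cosphere bundle, [1 / H] equals [H0 xi / H xi]; its power [m]
    times the density bound [H0 xi ^- n.+1] leaves [H0 xi ^- k * H xi ^- m]. Nonnegativity is
    included because monotonicity of the integral is used for nonnegative functions. *)
Lemma cosphere_integrand_le {R : realType} {n : nat} {M : smoothManifold R n.+1}
    (P : partition_of_unity M) (L L0 : finsler M) (a : 'I_(pou_size P)) (j : 'I_n.+1) (b : bool)
    (c : R) (k m : nat) (u : 'rV[R]_(n.+1 + n)) : (k + m = n.+1)%N ->
  (forall (z : 'rV[R]_(n.+1 + n.+1)) v, vol_form z v =
     c * \det (\matrix_a v (cast_ord (esym (basis_card n.+1)) a))) ->
  0 <= \1_[set u : 'rV[R]_(n.+1 + n) | img (pou_chart a) (lsubmx u) /\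
          forall k, `|rsubmx u ord0 k| <= 1] u *
       (pou_fun a (psi (pou_chart a) (lsubmx u)) *
        (1 / hamiltonian L (cot_point (pou_chart a) (cosphere_param L0 (pou_chart a) j b u)).1
               (cot_point (pou_chart a) (cosphere_param L0 (pou_chart a) j b u)).2) ^+ m *
        (orientation L0 (pou_chart a) j b u *
         Omega (cosphere_param L0 (pou_chart a) j b u) (cosphere_frame L0 (pou_chart a) j b u)))
    <= cone_weight P a u * (`|c| / n.+1%:R * ((cone_ham L0 (pou_chart a) j b u)^-1 ^+ k *
        (cone_ham L (pou_chart a) j b u)^-1 ^+ m)).
Proof.
move=> km Hc; set i := pou_chart a; set z := cosphere_param _ _ _ _ _.
have [[iq ry]|out] := pselect ([set u : 'rV[R]_(n.+1 + n) | img i (lsubmx u) /\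
              forall k, `|rsubmx u ord0 k| <= 1] u); last first.
  rewrite [X in X * _]indicE memNset // mul0r lexx /=.
  rewrite mulr_ge0 ?cone_weight_ge0 // mulr_ge0 ?divr_ge0 // mulr_ge0 // exprn_ge0 // invr_ge0 ham_ext_ge0 //.
rewrite [X in X * _]indicE mem_set // div1r mul1r.
set xi := cone_dir j ((-1) ^+ b) (rsubmx u).
have xi0 : xi != 0.
  by apply/eqP => /rowP /(_ j); rewrite !mxE unlift_none => /eqP; rewrite signr_eq0.
have G0 := gauge_coordP L0 i _ iq; have G1 := gauge_coordP L i _ iq.
pose h0 := dual_norm (gauge_coord L0 i (lsubmx u)) xi.
pose h1 := dual_norm (gauge_coord L i (lsubmx u)) xi.
have h00 : 0 < h0 by exact: dual_norm_gt0.
have h10 : 0 < h1 by exact: dual_norm_gt0.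
have -> : hamiltonian L (cot_point i z).1 (cot_point i z).2 = h0^-1 * h1.
  rewrite -[LHS]/(hamiltonian_coord L i z) /z /cosphere_param -/xi.
  by rewrite !hamiltonian_coordE // dual_normZ // invr_gt0.
have := orientation_OmegaE L0 i j b u c Hc; rewrite -/z -/xi hamiltonian_coordE // -/h0.
set W := orientation _ _ _ _ _ * _ => /andP[W0 WC].
have p0 : 0 <= pou_fun a (psi i (lsubmx u)) by exact: pou_ge0.
have f0 : 0 <= (h0^-1 * h1)^-1 ^+ m by rewrite exprn_ge0 // invr_ge0 mulr_ge0 ?invr_ge0 // ltW.
have pf0 := mulr_ge0 p0 f0.
apply/andP; split; first exact: mulr_ge0.
apply: (le_trans (ler_wpM2l pf0 WC)).
rewrite /cone_weight /cone_ham -/xi !ham_extE // -/h0 -/h1 /pou_ext.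
rewrite [in leRHS]indicE mem_set // mul1r [in leRHS]indicE mem_set // mulr1.
rewrite -mulrA ler_wpM2l // mulrCA ler_wpM2l ?divr_ge0 //.
rewrite gtr0_norm ?invr_gt0 // -km exprD mulrCA -!exprMn invfM invrK.
by rewrite mulrAC mulfV ?mul1r // gt_eqF.
Qed.

Theorem proposition4p1 (R : realType) (n : nat) (M : smoothManifold R n.+1)
    (Mcompact : compact [set: M]) (P : partition_of_unity M)
    (L L0 : finsler M) (k : nat) (le_kn : (k <= n.+1)%N) :
  Wtilde P k L L0 ^+ n.+1 <=
    holmes_thompson P L ^+ (n.+1 - k) / holmes_thompson P L0 ^+ (n.+1 - k).
Proof.
have [c Hc] := @vol_form_det R n.+1.
have km := subnKC le_kn; set m := (n.+1 - k)%N in km *.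
pose vol (K : finsler M) (a : 'I_(pou_size P)) : \bar R :=
  integral_rV (fun z : 'rV[R]_(n.+1 + n.+1) => (pou_ext P a (lsubmx z) *
    (`|c| * \1_[set z | (ham_ext K (pou_chart a) z <= 1)%R] z))%:E).
have vol0 K a : (0 <= vol K a)%E.
  by apply: integral_rV_ge0 => z; rewrite lee_fin mulr_ge0 ?pou_ext_ge0 // mulr_ge0.
have svol0 K : (0 <= \sum_(a < pou_size P) vol K a)%E by apply: sume_ge0 => a _.
have volE K : (\sum_(a < pou_size P) vol K a)%E = (cot_volume P (Dstar K))%:E.
  rewrite (cot_volumeE P K c Hc) fineK // ge0_fin_numE; last exact: svol0.
  by apply: lte_sum_pinfty => a _; exact: vol_chart_fin.
have V0 : forall K : finsler M, 0 <= cot_volume P (Dstar K).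
  by move=> K; move: (svol0 K); rewrite volE lee_fin.
pose sph (K : finsler M) (a : 'I_(pou_size P)) j b : \bar R :=
  integral_rV (fun u : 'rV[R]_(n.+1 + n) => (cone_weight P a u *
    (`|c| / n.+1%:R * (cone_ham K (pou_chart a) j b u)^-1 ^+ n.+1))%:E).
have sphV K : (\sum_a \sum_(j < n.+1) \sum_(b : bool) sph K a j b <= (cot_volume P (Dstar K))%:E)%E.
  by rewrite -volE; apply: lee_sum => a _; exact: polar_chart.
pose mix a j b : \bar R := integral_rV (fun u : 'rV[R]_(n.+1 + n) => (cone_weight P a u *
    (`|c| / n.+1%:R * ((cone_ham L0 (pou_chart a) j b u)^-1 ^+ k *
      (cone_ham L (pou_chart a) j b u)^-1 ^+ m)))%:E).
have mix0 a j b : (0 <= mix a j b)%E.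
  apply: integral_rV_ge0 => u; rewrite lee_fin mulr_ge0 ?cone_weight_ge0 // mulr_ge0 ?divr_ge0 //.
  by rewrite mulr_ge0 // exprn_ge0 // invr_ge0 ham_ext_ge0.
have sph0 K a j b : (0 <= sph K a j b)%E.
  apply: integral_rV_ge0 => u; rewrite lee_fin mulr_ge0 ?cone_weight_ge0 // mulr_ge0 ?divr_ge0 //.
  by rewrite exprn_ge0 // invr_ge0 ham_ext_ge0.
(* The triple sums are flattened so that sum comparisons and distributivity apply once. *)
pose I3 := ('I_(pou_size P) * ('I_n.+1 * bool))%type.
have sum3 (F : 'I_(pou_size P) -> 'I_n.+1 -> bool -> \bar R) :
    (\sum_a \sum_(j < n.+1) \sum_(b : bool) F a j b = \sum_(x : I3) F x.1 x.2.1 x.2.2)%E.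
  rewrite -(pair_bigA _ (fun a jb => F a jb.1 jb.2)) /=; apply: eq_bigr => a _.
  by rewrite -(pair_bigA _ (fun j b => F a j b)).
pose X := (\sum_a \sum_(j < n.+1) \sum_(b : bool) mix a j b)%E.
have X0 : (0 <= X)%E by rewrite /X sum3; apply: sume_ge0.
have AMGM s t : 0 < s -> 0 < t -> ((s ^+ k * t ^+ m)%:E * X <=
    ((k%:R * s ^+ n.+1 * cot_volume P (Dstar L0) + m%:R * t ^+ n.+1 * cot_volume P (Dstar L)) / n.+1%:R)%:E)%E.
  move=> s0 t0.
  have s1 : 0 <= k%:R * s ^+ n.+1 / n.+1%:R by rewrite divr_ge0 // mulr_ge0 // exprn_ge0 // ltW.
  have t1 : 0 <= m%:R * t ^+ n.+1 / n.+1%:R by rewrite divr_ge0 // mulr_ge0 // exprn_ge0 // ltW.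
  apply: (@le_trans _ _ ((k%:R * s ^+ n.+1 / n.+1%:R)%:E * (\sum_a \sum_(j < n.+1) \sum_(b : bool) sph L0 a j b) +
     (m%:R * t ^+ n.+1 / n.+1%:R)%:E * (\sum_a \sum_(j < n.+1) \sum_(b : bool) sph L a j b))%E).
    rewrite /X !sum3 !ge0_sume_distrr //; try by move=> x _.
    rewrite -big_split /=; apply: lee_sum => x _; exact: AMGM_chart.
  rewrite [leRHS](_ : _ = ((k%:R * s ^+ n.+1 / n.+1%:R)%:E * (cot_volume P (Dstar L0))%:E +
     (m%:R * t ^+ n.+1 / n.+1%:R)%:E * (cot_volume P (Dstar L))%:E)%E); last first.
    by rewrite -!EFinM -EFinD mulrDl !(mulrAC _ _ n.+1%:R^-1).
  by apply: leeD; apply: lee_wpmul2l; rewrite ?lee_fin //; exact: sphV.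
(* Finiteness of the mixed integral follows from the inequality at [s = t = 1]. *)
have Xfin : X \is a fin_num.
  rewrite ge0_fin_numE //; have := AMGM 1 1 ltr01 ltr01; rewrite !expr1n mul1r mul1e => /le_lt_trans; apply.
  exact: ltry.
pose x := fine X.
have x0 : 0 <= x by exact: fine_ge0.
have xE : X = x%:E by rewrite fineK.
have WX : 0 <= cosphere_integral P L0 (fun c => (1 / hamiltonian L c.1 c.2) ^+ m) (@Omega R n) <= x.
  rewrite /cosphere_integral; set S := (X in fine X).
  have S0X : (0 <= S <= X)%E.
    apply/andP; split.
      rewrite /S sum3; apply: sume_ge0 => y _; apply: integral_rV_ge0 => u; rewrite lee_fin.
      by have /andP[] := cosphere_integrand_le P L L0 y.1 y.2.1 y.2.2 c k m u km Hc.
    rewrite /S /X !sum3; apply: lee_sum => y _; apply: (@le_integral_rV R (n.+1 + n)) => u; rewrite lee_fin.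
      by have /andP[] := cosphere_integrand_le P L L0 y.1 y.2.1 y.2.2 c k m u km Hc.
    by have /andP[] := cosphere_integrand_le P L L0 y.1 y.2.1 y.2.2 c k m u km Hc.
  have /andP[S0 SX] := S0X; apply/andP; split; first exact: fine_ge0.
  rewrite -lee_fin -xE fineK // ge0_fin_numE // (le_lt_trans SX) // xE; exact: ltry.
set V := cot_volume P (Dstar L) in AMGM *; set U := cot_volume P (Dstar L0) in AMGM *.
have U0 : 0 <= U by exact: V0.
have W0 : 0 <= V by exact: V0.
have b0 := @ball_volume_gt0 R n.+1.
have rhsE : holmes_thompson P L ^+ m / holmes_thompson P L0 ^+ m = (V / U) ^+ m.
  rewrite /holmes_thompson -/U -/V -expr_div_n; congr (_ ^+ _).
  by rewrite invfM invrK mulrACA mulVf ?mulr1 // gt_eqF.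
rewrite rhsE /Wtilde -/m -/U.
(* With [U = 0] the inverse in [Wtilde] is zero, so the left side vanishes. *)
have [U00|Un0] := eqVneq U 0.
  by rewrite U00 invr0 mul0r expr0n /= exprn_ge0 // mulr0.
have Up : 0 < U by rewrite lt_neqAle eq_sym Un0.
have opt : x ^+ n.+1 <= U ^+ k * V ^+ m.
  apply: (optimize_AMGM n k m x U V km x0 Up W0) => s t s0 t0.
  by have := AMGM s t s0 t0; rewrite xE -EFinM lee_fin.
have /andP[cs0 csx] := WX.
apply: (@le_trans _ _ ((U^-1 * x) ^+ n.+1)).
  rewrite ler_pXn2r ?nnegrE ?mulr_ge0 ?invr_ge0 // ler_wpM2l // invr_ge0 //.
rewrite exprMn mulrC exprVn ler_pdivrMr ?exprn_gt0 //; apply: le_trans opt _.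
(* Writing [U ^+ n.+1] as [U ^+ k * U ^+ m] cancels the power [k] and leaves the ratio of the
   volumes. *)
rewrite expr_div_n -[in leRHS]km exprD.
have Um : U ^+ m != 0 by rewrite expf_neq0.
by rewrite mulrC mulrCA divfK // mulrC.
Qed.
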